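(* Let $(S,T_S)$ be a scaled simplicial set and let $f\colon X\to S$ be an inner fibration of simplicial sets. Let $T_X=f^{-1}(T_S)$ be the set of all triangles in $X$ whose image in $S$ belongs to $T_S$, and let $E_X$ be the set of edges in $X$ which are locally $f$-cocartesian. Then the following are equivalent: (1) $f\colon(X,T_X)\to(S,T_S)$ is an inner cocartesian fibration. (2) $f$ exhibits $(X,E_X)$ as $\mathfrak P_S$-fibered. In addition, when these two equivalent conditions hold, the set $E_X$ coincides with the set of $f$-cocartesian arrows in $(X,T_X)$.
   Context: A scaled simplicial set is a pair $(X,T_X)$ of a simplicial set and a set $T_X$ of 2-simplices (thin triangles) containing the degenerate ones; maps preserve thin triangles. $(X,T)$ means: thin triangles are those of $T$ and the degenerate ones; $T_{|L}$ is the set of triangles of $L\subseteq X$ lying in $T$. A weak fibration is a map of scaled simplicial sets with the right lifting property against: (1) $(\Lambda^n_i,\{\Delta^{\{i-1,i,i+1\}}\}_{|\Lambda^n_i})\subseteq(\Delta^n,\{\Delta^{\{i-1,i,i+1\}}\})$, $0<i<n$; (2) $(\Lambda^n_0\coprod_{\Delta^{\{0,1\}}}\Delta^0,\{\Delta^{\{0,1,n\}}\}_{|\Lambda^n_0})\subseteq(\Delta^n\coprod_{\Delta^{\{0,1\}}}\Delta^0,\{\Delta^{\{0,1,n\}}\})$, $n\ge2$; (3) $(\Lambda^n_n\coprod_{\Delta^{\{n-1,n\}}}\Delta^0,\{\Delta^{\{0,n-1,n\}}\}_{|\Lambda^n_n})\subseteq(\Delta^n\coprod_{\Delta^{\{n-1,n\}}}\Delta^0,\{\Delta^{\{0,n-1,n\}}\})$,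 $n\ge2$. A weak fibration is an inner fibration (of scaled simplicial sets) if it detects thin triangles (a triangle is thin iff its image is) and its underlying map is an inner fibration of simplicial sets. For a weak fibration $f$, an edge $e$ is $f$-cartesian if every square from $(\Lambda^n_n,\{\Delta^{\{0,n-1,n\}}\}_{|\Lambda^n_n})\subseteq(\Delta^n,\{\Delta^{\{0,n-1,n\}}\})$, $n\ge2$, to $f$ whose top map sends $\Delta^{\{n-1,n\}}$ to $e$ has a lift; $e$ is $f$-cocartesian if $e^{\mathrm{op}}$ is $f^{\mathrm{op}}$-cartesian. $f\colon X\to Y$ is an inner cartesian fibration if it is an inner fibration and for all $x\in X$ and every edge $e\colon y\to f(x)$ there is an $f$-cartesian edge with target $x$ lifting $e$; $f$ is an inner cocartesian fibration if $f^{\mathrm{op}}$ is an inner cartesian fibration. An edge of $X$ is locally $f$-cocartesian if, with $\overline e\colon\Delta^1\to S$ its image, it determines a cocartesian edge (in the usual simplicial sense) of $X\times_S\Delta^1\to\Delta^1$. For a scaled simplicial set $(S,T_S)$, a marked simplicial set $(X,E_X)$ with a map of simplicial sets $f\colon X\to S$ is $\mathfrak P_S$-fibered if: (i) $f$ is an inner fibration; (ii) for every edge $e\colon\Delta^1\to S$ the base change $e^*f\colon X\times_S\Delta^1\to\Delta^1$ is a cocartesian fibration and the marked edges of $X$ over $e$ are exactly the $e^*f$-cocartesian edges; (iii) for every edge $e\in E_X$ and every $\sigma\colon\Delta^2\to S$ in $T_S$ with $\sigma_{|\Delta^{\{0,1\}}}=f(e)$, the edge of $X\times_S\Delta^2$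 determined by $e$ is $\sigma^*f$-cocartesian. *)

(* Defs.v *)
From HB Require Import structures.
From Stdlib Require Import Relation_Operators.
From mathcomp Require Import all_boot generic_quotient.
From mathcomp Require Import boolp.

Set Implicit Arguments.
Unset Strict Implicit.
Unset Printing Implicit Defensive.

Local Open Scope quotient_scope.

Definition monotone m n (a : {ffun 'I_m.+1 -> 'I_n.+1}) : bool :=
  [forall i : 'I_m.+1, forall j : 'I_m.+1, (i <= j) ==> (a i <= a j)].

(* Morphisms [m] -> [n] of the simplex category, with [n] = 'I_n.+1. *)
Record ordmap (m n : nat) := OrdMap {
  ordmap_fun :> {ffun 'I_m.+1 -> 'I_n.+1};
  _ : monotone ordmap_fun
}.

HB.instance Definition _ m n := [isSub for @ordmap_fun m n].
HB.instance Definition _ m n := [Equality of ordmap m n by <:].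

Lemma ordmap_le m n (a : ordmap m n) (i j : 'I_m.+1) : i <= j -> a i <= a j.
Proof. by case: a => a /= /forallP /(_ i) /forallP /(_ j) /implyP. Qed.

Lemma ordmap_eq m n (a b : ordmap m n) : a =1 b -> a = b.
Proof. by move=> eq_ab; apply/val_inj/ffunP. Qed.

Lemma monotone_ffun m n (g : 'I_m.+1 -> 'I_n.+1) :
  (forall i j : 'I_m.+1, i <= j -> g i <= g j) -> monotone [ffun i => g i].
Proof.
by move=> g_le; apply/forallP => i; apply/forallP => j; apply/implyP => le_ij;
   rewrite !ffunE g_le.
Qed.

Definition mk_ordmap m n (g : 'I_m.+1 -> 'I_n.+1)
  (g_le : forall i j : 'I_m.+1, i <= j -> g i <= g j) : ordmap m n :=
  OrdMap (monotone_ffun g_le).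

Definition ord_id n : ordmap n n := mk_ordmap (g := id) (fun _ _ le_ij => le_ij).

Definition ord_comp l m n (b : ordmap m n) (a : ordmap l m) : ordmap l n :=
  mk_ordmap (g := fun i => b (a i))
    (fun i j le_ij => ordmap_le b (ordmap_le a le_ij)).

Definition ord_const m n (k : 'I_n.+1) : ordmap m n :=
  mk_ordmap (g := fun=> k) (fun _ _ _ => leqnn k).

Lemma ord_rev_le m n (a : ordmap m n) (i j : 'I_m.+1) :
  i <= j -> rev_ord (a (rev_ord i)) <= rev_ord (a (rev_ord j)).
Proof. by move=> le_ij /=; rewrite leq_sub2l // ltnS ordmap_le //= leq_sub2l. Qed.

(* The involution of the simplex category reversing the order of each [n]. *)
Definition ord_rev m n (a : ordmap m n) : ordmap m n :=
  mk_ordmap (@ord_rev_le m n a).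

Lemma first_edge_le n (i j : 'I_2) :
  i <= j -> @widen_ord 2 n.+2 isT i <= @widen_ord 2 n.+2 isT j.
Proof. by []. Qed.

(* The map [1] -> [n.+1] with vertices 0, 1. *)
Definition first_edge n : ordmap 1 n.+1 := mk_ordmap (@first_edge_le n).

Lemma last_edge_lt n (i : 'I_2) : n + i < n.+2.
Proof. by case: i => i i_lt /=; rewrite -[n.+2]addn2 ltn_add2l. Qed.

Lemma last_edge_le n (i j : 'I_2) :
  i <= j -> Ordinal (last_edge_lt n i) <= Ordinal (last_edge_lt n j).
Proof. by move=> le_ij /=; rewrite leq_add2l. Qed.

(* The map [1] -> [n.+1] with vertices n, n.+1. *)
Definition last_edge n : ordmap 1 n.+1 := mk_ordmap (@last_edge_le n).

Record sset := SSet {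
  simp :> nat -> Type;
  act : forall m n, ordmap m n -> simp n -> simp m;
  act_id : forall n (x : simp n), act (ord_id n) x = x;
  act_comp : forall l m n (b : ordmap m n) (a : ordmap l m) (x : simp n),
    act (ord_comp b a) x = act a (act b x)
}.

Record smap (X Y : sset) := SMap {
  smap_fun :> forall n, X n -> Y n;
  smap_act : forall m n (a : ordmap m n) (x : X n),
    smap_fun (act a x) = act a (smap_fun x)
}.

Definition scomp (X Y Z : sset) (g : smap Y Z) (f : smap X Y) : smap X Z.
Proof.
by exists (fun n x => g n (f n x)) => m n a x; rewrite !smap_act.
Defined.

Definition vertex (X : sset) n (x : X n) (k : 'I_n.+1) : X 0 :=
  act (ord_const 0 k) x.
Definition source (X : sset) (e : X 1) : X 0 := vertex e ord0.
Definition target (X : sset) (e : X 1) : X 0 := vertex e ord_max.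

(* A map [2] -> [1] is never injective, so it factors through a codegeneracy. *)
Definition degenerate_triangle (X : sset) (t : X 2) : Prop :=
  exists (a : ordmap 2 1) (e : X 1), t = act a e.

Definition degenerate_edge (X : sset) (e : X 1) : Prop :=
  exists (a : ordmap 1 0) (x : X 0), e = act a x.

Definition simplex (n : nat) : sset.
Proof.
exists (fun m => ordmap m n) (fun l m a b => ord_comp b a).
- by move=> m x; apply: ordmap_eq => i; rewrite !ffunE.
- by move=> l m k b a x; apply: ordmap_eq => i; rewrite !ffunE.
Defined.

(* The map [simplex n -> X] classified by an n-simplex of X. *)
Definition classify (X : sset) n (x : X n) : smap (simplex n) X.
Proof.
by exists (fun m (a : simplex n m) => act a x) => l m a b; rewrite act_comp.
Defined.

Definition sub_sset (X : sset) (P : forall n, X n -> Prop)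
  (P_act : forall m n (a : ordmap m n) (x : X n), P n x -> P m (act a x)) : sset.
Proof.
exists (fun n => {x : X n | P n x})
       (fun m n a x => exist _ (act a (sval x)) (P_act m n a (sval x) (svalP x))).
- by move=> n [x Px]; apply: eq_exist; rewrite /= act_id.
- by move=> l m n b a [x Px]; apply: eq_exist; rewrite /= act_comp.
Defined.

Definition sub_incl (X : sset) (P : forall n, X n -> Prop)
  (P_act : forall m n (a : ordmap m n) (x : X n), P n x -> P m (act a x)) :
  smap (sub_sset P_act) X.
Proof. by exists (fun n (x : sub_sset P_act n) => sval x). Defined.

Definition prod_sset (X Y : sset) : sset.
Proof.
exists (fun n => (X n * Y n)%type) (fun m n a p => (act a p.1, act a p.2)).
- by move=> n [x y] /=; rewrite !act_id.
- by move=> l m n b a [x y] /=; rewrite !act_comp.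
Defined.

Lemma pullback_act (X Y S : sset) (f : smap X S) (g : smap Y S)
  m n (a : ordmap m n) (p : prod_sset X Y n) :
  f n p.1 = g n p.2 -> f m (act a p).1 = g m (act a p).2.
Proof. by move=> fg; rewrite !smap_act fg. Qed.

Definition pullback (X Y S : sset) (f : smap X S) (g : smap Y S) : sset :=
  sub_sset (pullback_act (f := f) (g := g)).

Definition pullback_snd (X Y S : sset) (f : smap X S) (g : smap Y S) :
  smap (pullback f g) Y.
Proof. by exists (fun n (p : pullback f g n) => (sval p).2). Defined.

Definition op_sset (X : sset) : sset.
Proof.
exists X (fun m n a x => act (ord_rev a) x).
- move=> n x; rewrite -[RHS]act_id; congr act.
  by apply: ordmap_eq => i; rewrite !ffunE rev_ordK.
- move=> l m n b a x; rewrite -act_comp; congr act.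
  by apply: ordmap_eq => i; rewrite !ffunE rev_ordK.
Defined.

Definition op_smap (X Y : sset) (f : smap X Y) : smap (op_sset X) (op_sset Y).
Proof.
exists (fun n (x : op_sset X n) => f n x : op_sset Y n) => m n a x.
exact: (smap_act f (ord_rev a) x).
Defined.

(* A simplex of Delta^n lies in the i-th horn when it misses some vertex
   other than i. *)
Definition in_horn n (i : 'I_n.+1) m (a : simplex n m) : Prop :=
  exists2 j : 'I_n.+1, j != i & forall k, a k != j.

Lemma in_horn_act n (i : 'I_n.+1) l m (a : ordmap l m) (x : simplex n m) :
  in_horn i x -> in_horn i (act a x).
Proof. by case=> j ji xj; exists j => // k; rewrite ffunE. Qed.

Definition horn n (i : 'I_n.+1) : sset := sub_sset (@in_horn_act n i).

Definition horn_incl n (i : 'I_n.+1) : smap (horn i) (simplex n) :=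
  sub_incl (@in_horn_act n i).

Lemma first_edge_in_horn n : in_horn (ord0 : 'I_n.+3) (first_edge n.+1).
Proof. by exists (Ordinal (isT : 2 < n.+3)) => // -[[|[|k]] hk]; rewrite ffunE. Qed.

(* Delta^{0,1} in the 0-th horn of Delta^{n.+2}. *)
Definition horn_first_edge n : horn (ord0 : 'I_n.+3) 1 :=
  exist _ (first_edge n.+1) (@first_edge_in_horn n).

Lemma last_edge_in_horn n : in_horn (ord_max : 'I_n.+3) (last_edge n.+1).
Proof. by exists ord0 => // k; rewrite ffunE. Qed.

(* Delta^{n.+1,n.+2} in the last horn of Delta^{n.+2}. *)
Definition horn_last_edge n : horn (ord_max : 'I_n.+3) 1 :=
  exist _ (last_edge n.+1) (@last_edge_in_horn n).

Section Pushout.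
Variables (A B C : sset) (f : smap A B) (g : smap A C).

Inductive glue n : B n + C n -> B n + C n -> Prop :=
  Glue (a : A n) : glue (inl (f n a)) (inr (g n a)).

Definition glue_rel n : rel {classic (B n + C n)%type} :=
  fun x y => `[< clos_refl_sym_trans _ (@glue n) x y >].

Lemma glue_refl n : reflexive (@glue_rel n).
Proof. by move=> x; apply/asboolP; apply: rst_refl. Qed.

Lemma glue_sym n : symmetric (@glue_rel n).
Proof. by move=> x y; apply/asboolP/asboolP => xy; apply: rst_sym. Qed.

Lemma glue_trans n : transitive (@glue_rel n).
Proof.
by move=> y x z /asboolP xy /asboolP yz; apply/asboolP; apply: rst_trans xy yz.
Qed.

Canonical glue_equiv n :=
  EquivRel (@glue_rel n) (@glue_refl n) (@glue_sym n) (@glue_trans n).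

Definition pushout_simp n : Type := {eq_quot (@glue_equiv n)}.

Definition to_pushout n (x : B n + C n) : pushout_simp n :=
  \pi_({eq_quot (@glue_equiv n)}) (x : {classic (B n + C n)%type}).

Lemma to_pushout_eq n (x y : B n + C n) :
  clos_refl_sym_trans _ (@glue n) x y -> to_pushout x = to_pushout y.
Proof. by move=> xy; apply/eqmodP/asboolP. Qed.

Lemma repr_pushout n (x : B n + C n) :
  clos_refl_sym_trans _ (@glue n) (repr (to_pushout x)) x.
Proof.
suff /asboolP : glue_equiv n (repr (to_pushout x)) x by [].
by apply/eqmodP; rewrite reprK.
Qed.

Lemma to_pushout_repr n (q : pushout_simp n) : to_pushout (repr q) = q.
Proof. exact: reprK. Qed.

Definition act_sum m n (a : ordmap m n) (x : B n + C n) : B m + C m :=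
  match x with inl b => inl (act a b) | inr c => inr (act a c) end.

Lemma act_sum_glue m n (a : ordmap m n) (x y : B n + C n) :
  clos_refl_sym_trans _ (@glue n) x y ->
  clos_refl_sym_trans _ (@glue m) (act_sum a x) (act_sum a y).
Proof.
elim=> {x y} [_ _ [x]|x|x y _ xy|x y z _ xy _ yz].
- by rewrite /= -!smap_act; apply/rst_step/Glue.
- exact: rst_refl.
- exact: rst_sym.
- exact: rst_trans xy yz.
Qed.

Definition pushout : sset.
Proof.
exists pushout_simp (fun m n a q => to_pushout (act_sum a (repr q))).
- move=> n q; rewrite -[RHS]to_pushout_repr; congr to_pushout.
  by case: (repr q) => x /=; rewrite act_id.
- move=> l m n b a q.
  transitivity (to_pushout (act_sum a (act_sum b (repr q)))).
    by congr to_pushout; case: (repr q) => x /=; rewrite act_comp.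
  by apply/to_pushout_eq/act_sum_glue/rst_sym/repr_pushout.
Defined.

Definition pushout_inl : smap B pushout.
Proof.
exists (fun n b => to_pushout (inl b)) => m n a b.
exact: (to_pushout_eq (act_sum_glue a (rst_sym _ _ _ _ (repr_pushout (inl b))))).
Defined.

Definition pushout_inr : smap C pushout.
Proof.
exists (fun n c => to_pushout (inr c)) => m n a c.
exact: (to_pushout_eq (act_sum_glue a (rst_sym _ _ _ _ (repr_pushout (inr c))))).
Defined.

Lemma pushout_glue n (a : A n) : pushout_inl n (f n a) = pushout_inr n (g n a).
Proof. exact/to_pushout_eq/rst_step/Glue. Qed.

Section Desc.
Variables (Z : sset) (u : smap B Z) (v : smap C Z).
Hypothesis uv : forall n (a : A n), u n (f n a) = v n (g n a).

Definition desc_sum n (x : B n + C n) : Z n :=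
  match x with inl b => u n b | inr c => v n c end.

Lemma desc_sum_glue n (x y : B n + C n) :
  clos_refl_sym_trans _ (@glue n) x y -> desc_sum x = desc_sum y.
Proof.
by elim=> {x y} [_ _ [x]|x|x y _ xy|x y z _ xy _ yz] //=; rewrite ?uv ?xy.
Qed.

Definition pushout_desc : smap pushout Z.
Proof.
exists (fun n (q : pushout n) => desc_sum (repr (q : pushout_simp n))) => m n a q.
rewrite (desc_sum_glue (repr_pushout _)).
by case: (repr _) => x /=; rewrite smap_act.
Defined.

Lemma pushout_desc_inl n (b : B n) : pushout_desc n (pushout_inl n b) = u n b.
Proof. exact: (desc_sum_glue (repr_pushout (inl b))). Qed.

Lemma pushout_desc_inr n (c : C n) : pushout_desc n (pushout_inr n c) = v n c.
Proof. exact: (desc_sum_glue (repr_pushout (inr c))). Qed.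

End Desc.
End Pushout.

(* The pushout of X and Delta^0 along the map Delta^1 -> X classified by e. *)
Definition collapse (X : sset) (e : X 1) : sset :=
  pushout (classify e) (classify (X := simplex 0) (ord_const 1 ord0)).

Definition collapse_in (X : sset) (e : X 1) : smap X (collapse e) :=
  pushout_inl (classify e) (classify (X := simplex 0) (ord_const 1 ord0)).

Lemma collapse_map_glue (X Y : sset) (h : smap X Y) (e : X 1)
  n (a : simplex 1 n) :
  scomp (collapse_in (h 1 e)) h n (classify e n a) =
  pushout_inr (classify (h 1 e)) (classify (X := simplex 0) (ord_const 1 ord0)) n
    (classify (X := simplex 0) (ord_const 1 ord0) n a).
Proof. by rewrite -pushout_glue /= smap_act. Qed.

Definition collapse_map (X Y : sset) (h : smap X Y) (e : X 1) :
  smap (collapse e) (collapse (h 1 e)) :=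
  pushout_desc (@collapse_map_glue X Y h e).

Definition lifts (A B X Y : sset) (i : smap A B) (p : smap X Y)
  (u : smap A X) (v : smap B Y) : Prop :=
  exists w : smap B X,
    (forall n (a : A n), w n (i n a) = u n a) /\
    (forall n (b : B n), p n (w n b) = v n b).

Definition commutes (A B X Y : sset) (i : smap A B) (p : smap X Y)
  (u : smap A X) (v : smap B Y) : Prop :=
  forall n (a : A n), p n (u n a) = v n (i n a).

Definition inner_fibration (X Y : sset) (p : smap X Y) : Prop :=
  forall n (i : 'I_n.+1), 0 < i < n ->
  forall (u : smap (horn i) X) (v : smap (simplex n) Y),
    commutes (horn_incl i) p u v -> lifts (horn_incl i) p u v.

Definition cocartesian_edge (X Y : sset) (p : smap X Y) (e : X 1) : Prop :=
  forall n (u : smap (horn (ord0 : 'I_n.+3)) X) (v : smap (simplex n.+2) Y),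
    commutes (horn_incl _) p u v ->
    u 1 (horn_first_edge n) = e ->
    lifts (horn_incl _) p u v.

Definition cocartesian_fibration (X Y : sset) (p : smap X Y) : Prop :=
  inner_fibration p /\
  forall (x : X 0) (e : Y 1), source e = p 0 x ->
    exists e' : X 1, [/\ source e' = x, p 1 e' = e & cocartesian_edge p e'].

(* The projection X x_S Delta^n -> Delta^n for s : Delta^n -> S. *)
Definition base_change (X S : sset) (f : smap X S) n (s : S n) :
  smap (pullback f (classify s)) (simplex n) :=
  pullback_snd f (classify s).

(* The edge of X x_S Delta^n determined by an edge e of X lying over the edge
   a of Delta^n. *)
Definition base_change_edge (X S : sset) (f : smap X S) n (s : S n)
  (a : simplex n 1) (e : X 1) (fe : f 1 e = act a s) :
  pullback f (classify s) 1 :=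
  exist _ (e, a) fe.

Lemma over_id (S : sset) (d e : S 1) : d = e -> d = act (ord_id 1) e.
Proof. by rewrite act_id. Qed.

Definition base_change_edge1 (X S : sset) (f : smap X S) (s : S 1) (e : X 1)
  (fe : f 1 e = s) : pullback f (classify s) 1 :=
  base_change_edge (over_id fe).

Definition locally_cocartesian (X S : sset) (f : smap X S) (e : X 1) : Prop :=
  cocartesian_edge (base_change f (f 1 e)) (base_change_edge1 (erefl (f 1 e))).

Record scaled := Scaled {
  scaled_sset :> sset;
  thin : scaled_sset 2 -> Prop;
  thin_degenerate : forall t, degenerate_triangle t -> thin t
}.

Record scmap (X Y : scaled) := ScMap {
  scmap_smap :> smap X Y;
  scmap_thin : forall t : X 2, thin t -> thin (scmap_smap 2 t)
}.

(* (X, T): the thin triangles are those of T and the degenerate ones. *)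
Definition scale (X : sset) (T : X 2 -> Prop) : scaled :=
  @Scaled X (fun t => T t \/ degenerate_triangle t) (fun t => @or_intror _ _).

Lemma smap_degenerate (X Y : sset) (f : smap X Y) (t : X 2) :
  degenerate_triangle t -> degenerate_triangle (f 2 t).
Proof. by case=> a [e ->]; exists a, (f 1 e); rewrite smap_act. Qed.

Definition scale_map (X Y : sset) (f : smap X Y)
  (TX : X 2 -> Prop) (TY : Y 2 -> Prop) (fT : forall t, TX t -> TY (f 2 t)) :
  scmap (scale TX) (scale TY).
Proof.
by exists f => t [/fT|/(@smap_degenerate _ _ f)]; [left | right].
Defined.

Lemma preimage_degenerate (X : sset) (S : scaled) (f : smap X S) (t : X 2) :
  degenerate_triangle t -> thin (f 2 t).
Proof. by move=> /(@smap_degenerate _ _ f) /thin_degenerate. Qed.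

(* (X, f^{-1}(T_S)), and f as a map of scaled simplicial sets from it. *)
Definition preimage_scaled (X : sset) (S : scaled) (f : smap X S) : scaled :=
  Scaled (@preimage_degenerate X S f).

Definition preimage_map (X : sset) (S : scaled) (f : smap X S) :
  scmap (preimage_scaled f) S :=
  @ScMap (preimage_scaled f) S f (fun _ thin_ft => thin_ft).

Definition op_scaled (X : scaled) : scaled.
Proof.
exists (op_sset X) (@thin X) => t [a [e t_eq]].
by apply: thin_degenerate; exists (ord_rev a), e.
Defined.

Definition op_scmap (X Y : scaled) (f : scmap X Y) :
  scmap (op_scaled X) (op_scaled Y) :=
  @ScMap (op_scaled X) (op_scaled Y) (op_smap f) (@scmap_thin X Y f).

Definition sc_lifts (A B X Y : scaled) (i : scmap A B) (p : scmap X Y)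
  (u : scmap A X) (v : scmap B Y) : Prop :=
  exists w : scmap B X,
    (forall n (a : A n), w n (i n a) = u n a) /\
    (forall n (b : B n), p n (w n b) = v n b).

Definition sc_rlp (A B X Y : scaled) (i : scmap A B) (p : scmap X Y) : Prop :=
  forall (u : scmap A X) (v : scmap B Y),
    commutes i p u v -> sc_lifts i p u v.

(* The set {Delta^{i,j,k}} of triangles of Delta^n. *)
Definition triangle n (i j k : nat) (t : simplex n 2) : Prop :=
  [seq val (t l) | l <- enum 'I_3] = [:: i; j; k].

(* (Lambda^n_i, T_{|Lambda^n_i}) -> (Delta^n, T) *)
Definition sc_horn n (i : 'I_n.+1) (T : simplex n 2 -> Prop) : scaled :=
  scale (X := horn i) (fun t => T (horn_incl i 2 t)).

Definition sc_horn_incl n (i : 'I_n.+1) (T : simplex n 2 -> Prop) :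
  scmap (sc_horn i T) (scale T) :=
  @scale_map _ _ (horn_incl i) _ T (fun _ Tt => Tt).

(* The thin triangles are the images of those in T and the degenerate ones. *)
Definition sc_collapse (X : sset) (e : X 1) (T : X 2 -> Prop) : scaled :=
  scale (X := collapse e) (fun t => exists2 t', T t' & t = collapse_in e 2 t').

Lemma collapse_horn_thin n (i : 'I_n.+1) (e : horn i 1)
  (T : simplex n 2 -> Prop) (t : collapse e 2) :
  (exists2 t', T (horn_incl i 2 t') & t = collapse_in e 2 t') ->
  exists2 t', T t' &
    collapse_map (horn_incl i) e 2 t = collapse_in (horn_incl i 1 e) 2 t'.
Proof.
by case=> t' Tt' ->; exists (horn_incl i 2 t') => //; apply: pushout_desc_inl.
Qed.

Definition sc_collapse_horn_incl n (i : 'I_n.+1) (e : horn i 1)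
  (T : simplex n 2 -> Prop) :
  scmap (sc_collapse e (fun t => T (horn_incl i 2 t)))
        (sc_collapse (horn_incl i 1 e) T) :=
  scale_map (@collapse_horn_thin n i e T).

Record weak_fibration (X Y : scaled) (f : scmap X Y) : Prop := WeakFibration {
  weak_fibration_inner : forall n (i : 'I_n.+1), 0 < i < n ->
    sc_rlp (sc_horn_incl i (triangle i.-1 i i.+1)) f;
  weak_fibration_left : forall n,
    sc_rlp (sc_collapse_horn_incl (horn_first_edge n) (triangle 0 1 n.+2)) f;
  weak_fibration_right : forall n,
    sc_rlp (sc_collapse_horn_incl (horn_last_edge n) (triangle 0 n.+1 n.+2)) f
}.

Definition sc_inner_fibration (X Y : scaled) (f : scmap X Y) : Prop :=
  [/\ weak_fibration f,
      forall t : X 2, thin t <-> thin (f 2 t) &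
      inner_fibration f].

(* Of interest only when f is a weak fibration. *)
Definition sc_cartesian_edge (X Y : scaled) (f : scmap X Y) (e : X 1) : Prop :=
  forall n (T := triangle 0 n.+1 n.+2)
    (u : scmap (sc_horn (ord_max : 'I_n.+3) T) X) (v : scmap (scale T) Y),
    commutes (sc_horn_incl _ T) f u v ->
    u 1 (horn_last_edge n) = e ->
    sc_lifts (sc_horn_incl _ T) f u v.

(* The edges of X and of its opposite are the same. *)
Definition sc_cocartesian_edge (X Y : scaled) (f : scmap X Y) (e : X 1) : Prop :=
  sc_cartesian_edge (op_scmap f) e.

Definition inner_cartesian_fibration (X Y : scaled) (f : scmap X Y) : Prop :=
  sc_inner_fibration f /\
  forall (x : X 0) (e : Y 1), target e = f 0 x ->
    exists e' : X 1, [/\ target e' = x, f 1 e' = e & sc_cartesian_edge f e'].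

Definition inner_cocartesian_fibration (X Y : scaled) (f : scmap X Y) : Prop :=
  inner_cartesian_fibration (op_scmap f).

Definition is_marking (X : sset) (E : X 1 -> Prop) : Prop :=
  forall e, degenerate_edge e -> E e.

Record marked := Marked {
  marked_sset :> sset;
  mark : marked_sset 1 -> Prop;
  mark_degenerate : is_marking mark
}.

(* (X, E_X) is fibered over the categorical pattern P_S via f. *)
Record P_fibered (S : scaled) (X : marked) (f : smap X S) : Prop := PFibered {
  P_fibered_inner : inner_fibration f;
  P_fibered_edge : forall s : S 1,
    cocartesian_fibration (base_change f s) /\
    forall (e : X 1) (fe : f 1 e = s),
      mark e <-> cocartesian_edge (base_change f s) (base_change_edge1 fe);
  P_fibered_thin : forall (e : X 1) (s : S 2), mark e -> thin s ->
    forall fe : f 1 e = act (first_edge 1) s,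
      cocartesian_edge (base_change f s) (base_change_edge fe)
}.

(* Main.v *)
From HB Require Import structures.
From mathcomp Require Import all_boot zify.
From mathcomp Require Import boolp.
Require Import Defs.

(* Over a general base, degenerate edges need not have all cocartesian lifts,
   so everything is done relative to a fixed simplex v of S: an edge e is
   cocartesian over v when the 0-th horns over v with first edge e have fillers.
   Three facts drive the equivalence.
   (a) If e is cocartesian over the degenerate simplex (0, 1, ..., 1, n) of the
   triangle {0, 1, n} of v, it is cocartesian over v: the vertices 2, ..., n - 1
   are pulled back to the vertex 1 one at a time, by inner horns only.  This
   reduces the scaled lifting property to thin triangles.
   (b) If e and e' are locally cocartesian, with the same source and the same
   image, and e' is cocartesian over v, then so is e: a tetrahedron
   (x, y, y', y) makes the comparison edge y' -> y invertible enough to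
   transport fillers.
   (c) Outer horns with a degenerate outer edge have fillers over a constant
   simplex; over a thin triangle with a degenerate edge, cocartesian lifts of
   the other edges reduce to that case.
   In each argument a partially defined map on a larger simplex is extended
   step by step, faces being added in pairs c, c \ t for a fixed vertex t. *)

Set Implicit Arguments.
Unset Strict Implicit.
Unset Printing Implicit Defensive.

(** The two families of outer horns in a weak fibration are not symmetric here. Both ask degenerate
    edges to have fillers over simplices whose outer triangle is thin. On the cocartesian side this
    is the condition on marked edges over thin triangles, since degenerate edges are marked. On the
    cartesian side being fibered says nothing directly: a marked lift of the first edge of the thin
    triangle is used to move the problem to a simplex lying over a single vertex, where inner horns
    suffice. The obstacle throughout is that [v] is arbitrary away from its outer triangle. Hence an
    outer horn may be filled only at an edge already known to be cocartesian or cartesian over the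
    simplex at hand, and every other horn has to be inner. The auxiliary vertices are inserted for
    that purpose: each toggled vertex has a vertex of the face on either side. The scaling itself
    drops out early. As [f] detects thin triangles, any lift of underlying simplicial sets is a
    scaled one, and thinness only restricts which [v] are tested. *)

Local Notation vtx n k := (@Ordinal n k isT).

(** * Faces of a simplex as sets of vertices *)

Definition image m n (a : ordmap m n) : {set 'I_n.+1} := [set a i | i in 'I_m.+1].

Lemma mem_image m n (a : ordmap m n) i : a i \in image a.
Proof. exact: imset_f. Qed.

Lemma imageP m n (a : ordmap m n) j : reflect (exists i, j = a i) (j \in image a).
Proof. by apply: (iffP imsetP) => [[i _ ->]|[i ->]]; exists i. Qed.

Lemma image_comp l m n (a : ordmap m n) (b : ordmap l m) :
  image (ord_comp a b) = a @: image b.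
Proof.
by rewrite -imset_comp; apply: eq_imset => i; rewrite ffunE.
Qed.

Lemma image_compS l m n (a : ordmap m n) (b : ordmap l m) :
  image (ord_comp a b) \subset image a.
Proof. by apply/subsetP => _ /imageP[i ->]; rewrite ffunE mem_image. Qed.

Lemma ord_compA k l m n (a : ordmap m n) (b : ordmap l m) (c : ordmap k l) :
  ord_comp a (ord_comp b c) = ord_comp (ord_comp a b) c.
Proof. by apply: ordmap_eq => i; rewrite !ffunE. Qed.

Lemma ord_comp1 m n (a : ordmap m n) : ord_comp (ord_id n) a = a.
Proof. by apply: ordmap_eq => i; rewrite !ffunE. Qed.

Lemma ord_comp1r m n (a : ordmap m n) : ord_comp a (ord_id m) = a.
Proof. by apply: ordmap_eq => i; rewrite !ffunE. Qed.

Lemma injective_lt m n (d : ordmap m n) (i j : 'I_m.+1) :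
  injective d -> i < j -> d i < d j.
Proof.
move=> d_inj lt_ij; rewrite ltn_neqAle ordmap_le ?(ltnW lt_ij) // andbT.
by apply/eqP => /val_inj/d_inj eq_ij; rewrite eq_ij ltnn in lt_ij.
Qed.

Lemma injective_leE m n (d : ordmap m n) (i j : 'I_m.+1) :
  injective d -> (d i <= d j) = (i <= j).
Proof.
move=> d_inj; case: (leqP i j) => [/(ordmap_le d) //|lt_ji].
by apply/negbTE; rewrite -ltnNge injective_lt.
Qed.

Section Retraction.
Variables (m n : nat) (d : ordmap m n).

(** The right adjoint of [d], extended by 0 below the first value of [d], where the maximum is
    empty. That extension is harmless: [retractionK_image] only concerns simplices with image inside
    that of [d]. *)
Definition retraction_fun (j : 'I_n.+1) : 'I_m.+1 :=
  inord (\max_(i : 'I_m.+1 | d i <= j) i).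

Lemma retraction_bound (j : 'I_n.+1) : \max_(i : 'I_m.+1 | d i <= j) i < m.+1.
Proof. by rewrite ltnS; apply/bigmax_leqP => i _; rewrite -ltnS. Qed.

Lemma retraction_le (i j : 'I_n.+1) :
  i <= j -> retraction_fun i <= retraction_fun j.
Proof.
move=> le_ij; rewrite /retraction_fun !inordK ?retraction_bound //.
by apply/bigmax_leqP => k le_ki; apply: leq_bigmax_cond; apply: leq_trans le_ij.
Qed.

Definition retraction : ordmap n m := mk_ordmap retraction_le.

Lemma retractionK : injective d -> cancel d retraction.
Proof.
move=> d_inj i; rewrite ffunE; apply/val_inj; rewrite /= inordK ?retraction_bound //.
apply/eqP; rewrite eqn_leq; apply/andP; split; last exact: leq_bigmax_cond.
by apply/bigmax_leqP => j; rewrite injective_leE.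
Qed.

Lemma retractionK_image l (a : ordmap l n) :
  injective d -> image a \subset image d -> ord_comp d (ord_comp retraction a) = a.
Proof.
move=> d_inj /subsetP a_sub; apply: ordmap_eq => i; rewrite ffunE ffunE.
by have /imageP[j ->] := a_sub _ (mem_image a i); rewrite retractionK.
Qed.

End Retraction.

(** The increasing enumeration of [c]. The vertex [t] makes [c] nonempty and is the default value of
    [nth]. *)
Lemma face_inclusion n (c : {set 'I_n.+1}) (t : 'I_n.+1) :
  t \in c -> exists m (d : ordmap m n), injective d /\ image d = c.
Proof.
move=> tc; have c_gt0 : 0 < #|c| by apply/card_gt0P; exists t.
have sz : size (enum c) = #|c|.-1.+1 by rewrite -cardE prednK.
have enum_sorted : sorted ltn (map val (enum c)).
  rewrite sorted_map /enum_mem -enumT sorted_filter //; last first.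
    by rewrite -sorted_map val_enum_ord iota_ltn_sorted.
  by move=> ? ? ?; apply: ltn_trans.
pose g (i : 'I_#|c|.-1.+1) := nth t (enum c) i.
have g_lt (i j : 'I_#|c|.-1.+1) : i < j -> g i < g j.
  move=> lt_ij; have := sorted_ltn_nth ltn_trans 0 enum_sorted.
  move/(_ i j); rewrite !inE size_map sz !ltn_ord => /(_ isT isT lt_ij).
  by rewrite !(nth_map t) // sz.
have g_le (i j : 'I_#|c|.-1.+1) : i <= j -> g i <= g j.
  by rewrite leq_eqVlt => /orP[/eqP/val_inj -> //|/g_lt/ltnW].
exists _, (mk_ordmap g_le); split.
  move=> i j; rewrite !ffunE => eq_g; apply/val_inj.
  by case: (ltngtP i j) => // /g_lt; rewrite eq_g ltnn.
apply/setP => j; apply/imageP/idP => [[i ->]|jc].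
  by rewrite ffunE -mem_enum mem_nth ?sz.
have idx : index j (enum c) < #|c|.-1.+1 by rewrite -sz index_mem mem_enum.
by exists (Ordinal idx); rewrite ffunE /g /= nth_index ?mem_enum.
Qed.

(** * Partial lifts on subcomplexes and their extension along horns *)

Definition down_closed n (K : pred {set 'I_n.+1}) : Prop :=
  forall c d : {set 'I_n.+1}, d \subset c -> K c -> K d.

(* A map from a subcomplex of Delta^n to X is encoded as a function on all
   simplices of Delta^n, only meaningful on those whose image lies in K. *)
Definition simp_family (X : sset) n := forall m, ordmap m n -> X m.

Definition natural_on (X : sset) n (K : pred {set 'I_n.+1}) (phi : simp_family X n) :=
  forall l m (a : ordmap m n) (b : ordmap l m),
    K (image a) -> phi l (ord_comp a b) = act b (phi m a).

Definition partial_lift (X S : sset) (f : smap X S) n (v : S n)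
  (K : pred {set 'I_n.+1}) (phi : simp_family X n) : Prop :=
  natural_on K phi /\ forall m (a : ordmap m n), K (image a) -> f m (phi m a) = act a v.

Definition agree_on (X : sset) n (K : pred {set 'I_n.+1}) (phi psi : simp_family X n) :=
  forall m (a : ordmap m n), K (image a) -> phi m a = psi m a.

Definition horn_faces n (i : 'I_n.+1) : pred {set 'I_n.+1} :=
  fun c => ~~ ([set~ i] \subset c).

Lemma horn_facesP n (i : 'I_n.+1) (c : {set 'I_n.+1}) :
  reflect (exists2 j, j != i & j \notin c) (horn_faces i c).
Proof.
by apply: (iffP subsetPn) => -[j]; rewrite ?inE => h1 h2; exists j => //; rewrite !inE in h1 *.
Qed.

Definition fills (X S : sset) (f : smap X S) n (i : 'I_n.+1) (v : S n)
  (phi : simp_family X n) : Prop :=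
  exists2 x : X n, f n x = v &
    forall m (a : ordmap m n), horn_faces i (image a) -> phi m a = act a x.

Definition pull (X : sset) m n (d : ordmap m n) (phi : simp_family X n) : simp_family X m :=
  fun l a => phi l (ord_comp d a).

Section Extension.
Variables (X S : sset) (f : smap X S) (n : nat) (v : S n) (t : 'I_n.+1).

(** Toggling [t] matches the faces of [L] outside [K] in pairs. Take such a face [c] through [t] of
    least cardinality: by minimality its facets through [t] are in [K], whereas [c :\ t] is not. So
    the part of [c] already defined is exactly its horn at [t], and a filler adds both [c] and
    [c :\ t]. The filling hypothesis is stated for every [psi] agreeing with [phi] on [K] because
    the family grows along the induction. *)
Lemma extend_along_horns (K L : pred {set 'I_n.+1}) (phi : simp_family X n) :
  down_closed K -> down_closed L -> subpred K L ->
  (forall c, L c -> ~~ K c -> L (t |: c) && ~~ K (c :\ t)) ->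
  partial_lift f v K phi ->
  (forall psi, agree_on K psi phi ->
     forall m (d : ordmap m n) (i : 'I_m.+1), injective d -> d i = t ->
     L (image d) -> ~~ K (image d) ->
     partial_lift f (act d v) (horn_faces i) (pull d psi) ->
     fills f i (act d v) (pull d psi)) ->
  exists2 psi, partial_lift f v L psi & agree_on K psi phi.
Proof.
move=> K_down L_down; move k_eq: #|[set c | L c && ~~ K c]| => k.
elim/ltn_ind: k K phi K_down k_eq => k IH K phi K_down k_eq KL toggle phi_lift fill.
case: (pickP [pred c | [&& L c, ~~ K c & t \in c]]) => [c0 c0P | noc]; last first.
  (* No missing face contains [t]; then no face is missing at all, since adding [t] to a missing
     face gives another one. *)
  have LK c : L c -> K c.
    move=> Lc; apply: contraT => nKc; have /andP[Ltc _] := toggle c Lc nKc.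
    have := noc (t |: c); rewrite /= Ltc setU11 andbT.
    by move/negbFE => /(K_down _ _ (subsetUr _ _)) Kc; rewrite Kc in nKc.
  by exists phi => //; split => [l m a b /LK|m a /LK]; apply phi_lift.
have {c0 c0P} [c [Lc nKc tc c_min]] : exists c : {set 'I_n.+1},
    [/\ L c, ~~ K c, t \in c &
      forall e, L e -> ~~ K e -> t \in e -> #|c| <= #|e|].
  case: (arg_minnP (fun c : {set 'I_n.+1} => #|c|) c0P) => c /and3P[Lc nKc tc] c_min.
  by exists c; split=> // e Le nKe te; apply: c_min; rewrite /= Le nKe.
have [m [d [d_inj d_im]]] := face_inclusion tc.
have /andP[_ nKct] := toggle c Lc nKc.
have face_K j : j \in c -> j != t -> K (c :\ j).
  move=> jc jt; apply: contraT => nK.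
  have := c_min (c :\ j) (L_down _ _ (subD1set _ _) Lc) nK.
  by rewrite !inE eq_sym jt tc [#|c|](cardsD1 j) jc add1n ltnn => /(_ isT).
have face_K' (e : {set 'I_n.+1}) : e \subset c -> e != c -> e != c :\ t -> K e.
  move=> sub ne1 ne2.
  have [j jc /andP[jt je]] : exists2 j, j \in c & (j != t) && (j \notin e).
    have: ~~ (c :\ t \subset e).
      apply/negP => sub'; have [te|te] := boolP (t \in e).
        by case/negP: ne1; rewrite eqEsubset sub -(setD1K tc) subUset sub1set te.
      by case/negP: ne2; rewrite eqEsubset sub' subsetD1 sub te.
    by case/subsetPn => j; rewrite !inE => /andP[jt jc] je; exists j; rewrite ?jt.
  by apply: K_down (face_K j jc jt); rewrite subsetD1 sub.
pose r := retraction d.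
have [i di] : exists i, t = d i by apply/imageP; rewrite d_im.
have horn_K l (a : ordmap l m) : horn_faces i (image a) -> K (image (ord_comp d a)).
  case/horn_facesP => j ji ja; apply: (K_down (c :\ d j)).
    rewrite subsetD1 -d_im image_compS image_comp /=.
    by apply/imsetP => -[j' j'a /d_inj eq_j]; rewrite -eq_j in j'a; rewrite j'a in ja.
  by apply: face_K; rewrite -?d_im ?mem_image // di (inj_eq d_inj).
have [x fx xP] : fills f i (act d v) (pull d phi).
  apply: fill => //; rewrite ?d_im //; split => [l l' a b|l a] /horn_K Ka.
    by rewrite /pull ord_compA (proj1 phi_lift).
  by rewrite /pull (proj2 phi_lift) // act_comp.
pose K' e := [|| K e, e == c | e == c :\ t].
(* A new simplex factors through [d], and the retraction computes the factorization. *)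
pose phi' : simp_family X n := fun l a =>
  if K (image a) then phi l a else act (ord_comp r a) x.
have K'_sub e : K' e -> ~~ K e -> e \subset c.
  by case/or3P => [->//|/eqP-> //|/eqP-> _]; apply: subD1set.
have K'_down : down_closed K'.
  move=> e e' sub K'e; have [Ke|nKe] := boolP (K e).
    by rewrite /K' (K_down _ _ sub Ke).
  rewrite /K'; apply/or3P.
  have [|ne1] := boolP (e' == c); first by constructor 2.
  have [|ne2] := boolP (e' == c :\ t); first by constructor 3.
  by constructor 1; apply: face_K' => //; apply: subset_trans sub (K'_sub _ K'e nKe).
have phi'K : agree_on K phi' phi by move=> l a Ka; rewrite /phi' Ka.
have phi'_lift : partial_lift f v K' phi'.
  split => [l l' a b|l a] K'a.
    have [Ka|nKa] := boolP (K (image a)).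
      by rewrite !phi'K ?(proj1 phi_lift) //; apply: K_down Ka; apply: image_compS.
    have ac := K'_sub _ K'a nKa.
    rewrite {2}/phi' (negbTE nKa) -act_comp -ord_compA.
    (* The only compatibility to check: a face of a new simplex that was already in [K]. It cannot
       contain [c :\ t], so it lies in the horn on which [x] restricts to [phi]. *)
    rewrite /phi'; case: ifP => // Kab.
    have abE : ord_comp d (ord_comp r (ord_comp a b)) = ord_comp a b.
      by rewrite retractionK_image // d_im; apply: subset_trans ac; apply: image_compS.
    rewrite -xP /pull ?abE //; apply/horn_facesP.
    have: ~~ (c :\ t \subset image (ord_comp a b)).
      by apply: contra nKct => /K_down; apply.
    case/subsetPn => j; rewrite !inE => /andP[jt]; rewrite -d_im => /imageP[j' ej] jab.
    exists j'; first by apply: contra jt; rewrite ej di => /eqP->.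
    by apply: contra jab => h; rewrite -abE image_comp ej; apply: imset_f.
  have [Ka|nKa] := boolP (K (image a)); first by rewrite phi'K ?(proj2 phi_lift).
  rewrite /phi' (negbTE nKa) smap_act fx -act_comp retractionK_image // d_im.
  exact: K'_sub.
have [||||psi psi_lift psiK'] := IH _ _ K' phi' K'_down erefl _ _ phi'_lift.
- rewrite -k_eq; apply: proper_card; apply/properP; split.
    apply/subsetP => e; rewrite !inE => /andP[->].
    by rewrite /K' negb_or => /andP[->].
  by exists c; rewrite !inE ?Lc ?nKc // /K' eqxx orbT andbF.
- move=> e /or3P[/KL//|/eqP->//|/eqP->]; exact: L_down (subD1set _ _) Lc.
- move=> e Le; rewrite /K' !negb_or => /and3P[nKe ec ect].
  have /andP[-> nKet] := toggle e Le nKe; rewrite nKet /=.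
  have [te|te] := boolP (t \in e).
    apply/andP; split; apply/eqP => eq_e.
      by have := setD11 t e; rewrite eq_e tc.
    by case/eqP: ec; rewrite -(setD1K te) eq_e setD1K.
  have etE : e :\ t = e by apply/setDidPl; rewrite disjoint_sym disjoints1 te.
  by rewrite etE ec ect.
- move=> psi agr l d' i' d'_inj d'i Ld' nK'd'; apply: fill => //.
    by move=> l' a Ka; rewrite agr ?phi'K // /K' Ka.
  by apply: contra nK'd'; rewrite /K' => ->.
by exists psi => // l a Ka; rewrite psiK' ?phi'K // /K' Ka.
Qed.

End Extension.

Lemma inner_horn_fills (X S : sset) (f : smap X S) n (i : 'I_n.+1) (v : S n)
  (phi : simp_family X n) :
  inner_fibration f -> 0 < i < n -> partial_lift f v (horn_faces i) phi ->
  fills f i v phi.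
Proof.
move=> f_inner i_inner [phi_nat phi_v].
have hornP m (a : horn i m) : horn_faces i (image (sval a)).
  case: a => a [j ji aj]; apply/horn_facesP; exists j => //=.
  by apply/imageP => -[k jk]; have := aj k; rewrite jk eqxx.
have [w [wu wv]] : lifts (horn_incl i) f
    (SMap (smap_fun := fun m (a : horn i m) => phi m (sval a))
       (fun l m b a => phi_nat _ _ _ b (hornP m a)))
    (classify v).
  by apply: f_inner => // m a; apply: phi_v (hornP m a).
exists (w n (ord_id n)); first by rewrite wv /= act_id.
move=> m a /horn_facesP[j ji ja].
have ha : in_horn i (a : simplex n m).
  by exists j => // k; apply: contra ja => /eqP<-; apply: mem_image.
rewrite -[LHS](wu m (exist _ a ha)) /= -smap_act /=.
by rewrite ord_comp1.
Qed.

(** A vertex of the face before [t] and another after it make the horn at [t] inner, so these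
    extensions work over any [v]. *)
Lemma extend_inner (X S : sset) (f : smap X S) n (v : S n) (t : 'I_n.+1)
  (K L : pred {set 'I_n.+1}) (phi : simp_family X n) :
  inner_fibration f -> down_closed K -> down_closed L -> subpred K L ->
  (forall c, L c -> ~~ K c ->
     [/\ L (t |: c), ~~ K (c :\ t),
         exists2 l : 'I_n.+1, l \in c & l < t & exists2 u : 'I_n.+1, u \in c & t < u]) ->
  partial_lift f v K phi ->
  exists2 psi, partial_lift f v L psi & agree_on K psi phi.
Proof.
move=> f_inner K_down L_down KL toggle phi_lift.
apply: (@extend_along_horns _ _ f n v t K L phi) => //.
  by move=> c Lc nKc; have [-> ->] := toggle c Lc nKc.
move=> psi _ m d i d_inj di Ld nKd; apply: inner_horn_fills => //.
have [_ _ [l /imageP[l' ->]] + [u /imageP[u' ->]]] := toggle _ Ld nKd.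
rewrite -di => lt_l lt_u.
have lt (x y : 'I_m.+1) : d x < d y -> x < y.
  by rewrite !ltnNge injective_leE.
by rewrite (leq_ltn_trans _ (lt _ _ lt_l)) //=; apply: leq_trans (lt _ _ lt_u) _; rewrite -ltnS.
Qed.

Definition glued (X : sset) n (K : pred {set 'I_n.+1}) (phi psi : simp_family X n) :
  simp_family X n := fun m a => if K (image a) then phi m a else psi m a.

Lemma glued_l (X : sset) n (K : pred {set 'I_n.+1}) (phi psi : simp_family X n) :
  agree_on K (glued K phi psi) phi.
Proof. by move=> m a Ka; rewrite /glued Ka. Qed.

Lemma glued_r (X : sset) n (K L : pred {set 'I_n.+1}) (phi psi : simp_family X n) :
  agree_on (predI K L) phi psi -> agree_on L (glued K phi psi) psi.
Proof.
by move=> agr m a La; rewrite /glued; case: ifP => // Ka; rewrite agr //= Ka.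
Qed.

Lemma glued_lift (X S : sset) (f : smap X S) n (v : S n) (K L : pred {set 'I_n.+1})
  (phi psi : simp_family X n) :
  down_closed K -> down_closed L -> agree_on (predI K L) phi psi ->
  partial_lift f v K phi -> partial_lift f v L psi ->
  partial_lift f v (predU K L) (glued K phi psi).
Proof.
move=> K_down L_down agr [phi_nat phi_v] [psi_nat psi_v].
split=> [l m a b|m a] /orP[Ka|La].
- rewrite !glued_l //; first exact: phi_nat.
  by apply: K_down Ka; apply: image_compS.
- rewrite !(glued_r agr) //; first exact: psi_nat.
  by apply: L_down La; apply: image_compS.
- by rewrite glued_l // phi_v.
- by rewrite (glued_r agr) // psi_v.
Qed.

Lemma pull_lift (X S : sset) (f : smap X S) m n (v : S n) (d : ordmap m n)
  (K : pred {set 'I_n.+1}) (L : pred {set 'I_m.+1}) (phi : simp_family X n) :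
  partial_lift f v K phi -> (forall c, L c -> K (d @: c)) ->
  partial_lift f (act d v) L (pull d phi).
Proof.
move=> [phi_nat phi_v] LK; split=> [l k a b|k a] /LK; rewrite -image_comp => Ka.
  by rewrite /pull ord_compA phi_nat.
by rewrite /pull phi_v // act_comp.
Qed.

Lemma lift_sub (X S : sset) (f : smap X S) n (v : S n)
  (K L : pred {set 'I_n.+1}) (phi : simp_family X n) :
  partial_lift f v K phi -> subpred L K -> partial_lift f v L phi.
Proof. by move=> [phi_nat phi_v] LK; split=> [l m a b|m a] /LK; auto. Qed.

(** * Maps of ordinals given by formulas, and conditions on blocks of vertices *)

Definition nat_ordmap m n (g : nat -> nat) (g_le : {homo g : i j / i <= j}) :
  ordmap m n.
Proof.
apply: (@mk_ordmap m n (fun i => inord (minn (g i) n))) => i j le_ij.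
by have := g_le _ _ le_ij; rewrite !inordK; lia.
Defined.

Lemma nat_ordmapE m n g g_le (i : 'I_m.+1) :
  @nat_ordmap m n g g_le i = minn (g i) n :> nat.
Proof. by rewrite ffunE inordK // ltnS geq_minr. Qed.

Lemma first_edgeE n (i : 'I_2) : first_edge n i = i :> nat.
Proof. by rewrite ffunE. Qed.

Lemma last_edgeE n (i : 'I_2) : last_edge n i = n + i :> nat.
Proof. by rewrite ffunE. Qed.

Lemma ord_constE m n (k : 'I_n.+1) i : ord_const m k i = k.
Proof. by rewrite ffunE. Qed.

Lemma ord_idE n (i : 'I_n.+1) : ord_id n i = i.
Proof. by rewrite ffunE. Qed.

Lemma ord_compE l m n (b : ordmap m n) (a : ordmap l m) i : ord_comp b a i = b (a i).
Proof. by rewrite ffunE. Qed.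

Definition ordmapE := (ord_compE, ord_idE, ord_constE, first_edgeE, last_edgeE,
  nat_ordmapE).

Lemma ordmap_eqn m n (a b : ordmap m n) : (forall i, a i = b i :> nat) -> a = b.
Proof. by move=> eq_ab; apply: ordmap_eq => i; apply: ord_inj; apply: eq_ab. Qed.

(** Here [P] singles out a block of vertices. The subcomplexes below are boolean combinations of
    conditions [i \notin c], [misses P c] and [~~ meets P c]. Toggling a vertex outside the block
    changes neither [misses] nor [meets], so the pairing condition of the extension lemmas becomes
    the finite case analysis done by [bool_cases]. *)
Definition misses n (P : pred nat) (c : {set 'I_n.+1}) : bool :=
  [exists i : 'I_n.+1, P i && (i \notin c)].

Definition meets n (P : pred nat) (c : {set 'I_n.+1}) : bool :=
  [exists i : 'I_n.+1, P i && (i \in c)].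

Lemma missesP n (P : pred nat) (c : {set 'I_n.+1}) :
  reflect (exists2 i : 'I_n.+1, P i & i \notin c) (misses P c).
Proof.
apply: (iffP existsP) => [[i /andP[Pi ic]]|[i Pi ic]]; exists i => //.
by rewrite Pi.
Qed.

Lemma meetsP n (P : pred nat) (c : {set 'I_n.+1}) :
  reflect (exists2 i : 'I_n.+1, P i & i \in c) (meets P c).
Proof.
apply: (iffP existsP) => [[i /andP[Pi ic]]|[i Pi ic]]; exists i => //.
by rewrite Pi.
Qed.

Section Meets.
Variables (n : nat) (P : pred nat) (c : {set 'I_n.+1}) (t : 'I_n.+1).

Lemma missesS (d : {set 'I_n.+1}) : d \subset c -> misses P c -> misses P d.
Proof.
by move=> /subsetP dc /missesP[i Pi ic]; apply/missesP; exists i => //; apply: contra ic => /dc.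
Qed.

Lemma meetsS (d : {set 'I_n.+1}) : d \subset c -> meets P d -> meets P c.
Proof. by move=> /subsetP dc /meetsP[i Pi /dc ic]; apply/meetsP; exists i. Qed.

Hypothesis Pt : ~~ P t.

Lemma misses_setU1 : misses P (t |: c) = misses P c.
Proof.
apply: eq_existsb => i; rewrite in_setU1; have [->|//] := eqVneq i t.
by rewrite (negbTE Pt).
Qed.

Lemma misses_setD1 : misses P (c :\ t) = misses P c.
Proof.
apply: eq_existsb => i; rewrite in_setD1; have [->|//] := eqVneq i t.
by rewrite (negbTE Pt).
Qed.

Lemma meets_setU1 : meets P (t |: c) = meets P c.
Proof.
apply: eq_existsb => i; rewrite in_setU1; have [->|//] := eqVneq i t.
by rewrite (negbTE Pt).
Qed.

Lemma meets_setD1 : meets P (c :\ t) = meets P c.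
Proof.
apply: eq_existsb => i; rewrite in_setD1; have [->|//] := eqVneq i t.
by rewrite (negbTE Pt).
Qed.

End Meets.

Lemma down_closedU n (K L : pred {set 'I_n.+1}) :
  down_closed K -> down_closed L -> down_closed (fun c => K c || L c).
Proof.
by move=> K_down L_down c d dc /orP[/(K_down _ _ dc)->|/(L_down _ _ dc)->]; rewrite ?orbT.
Qed.

Lemma down_closedI n (K L : pred {set 'I_n.+1}) :
  down_closed K -> down_closed L -> down_closed (fun c => K c && L c).
Proof. by move=> K_down L_down c d dc /andP[/(K_down _ _ dc)-> /(L_down _ _ dc)->]. Qed.

Lemma down_closed_notin n (i : 'I_n.+1) : down_closed (fun c => i \notin c).
Proof. by move=> c d /subsetP dc; apply/contra/dc. Qed.

Lemma down_closed_misses n P : down_closed (@misses n P).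
Proof. by move=> c d dc; apply: missesS. Qed.

Lemma down_closed_not_meets n P : down_closed (fun c => ~~ @meets n P c).
Proof. by move=> c d dc; apply/contra/meetsS. Qed.

Ltac down_closed_tac := repeat first [apply: down_closed_notin |
  apply: down_closed_misses | apply: down_closed_not_meets | apply: down_closedI |
  apply: down_closedU].

Ltac bool_cases := repeat (
  match goal with
  | |- context [in_mem ?i ?c] => case: (in_mem i c)
  | |- context [misses ?P ?c] => case: (misses P c)
  | |- context [meets ?P ?c] => case: (meets P c)
  end; rewrite /=; try by []).

Lemma injective_gap m n (d : ordmap m n) (i j : 'I_m.+1) :
  injective d -> i <= j -> d i + (j - i) <= d j.
Proof.
move=> d_inj; move k_eq: (j - i) => k.
elim: k j k_eq => [|k IH] j k_eq le_ij; first by rewrite addn0 ordmap_le.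
have j_gt0 : j.-1 < m.+1 by have := ltn_ord j; lia.
have := IH (Ordinal j_gt0); rewrite /= addnS => /(_ _ _)/leq_ltn_trans; apply; try lia.
by apply: injective_lt => //=; lia.
Qed.

Lemma injective_endo m (a : ordmap m m) : injective a -> a = ord_id m.
Proof.
move=> a_inj; apply: ordmap_eqn => i; rewrite ordmapE.
have := injective_gap (i := ord0) (j := i) a_inj (leq0n _).
have := injective_gap (i := i) (j := ord_max) a_inj (leq_ord _).
by have := ltn_ord (a ord_max); have := ltn_ord i; rewrite /=; lia.
Qed.

(** [extend_along_horns] hands over a face through some injection onto it; this replaces that
    injection by a prescribed one. The dependent pair is needed because the dimensions are only
    provably equal. *)
Lemma face_unique m m' n (d : ordmap m n) (d' : ordmap m' n) :
  injective d -> injective d' -> image d = image d' ->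
  existT (fun k => ordmap k n) m d = existT (fun k => ordmap k n) m' d'.
Proof.
move=> d_inj d'_inj eq_im.
have eq_m : m = m'.
  apply/succn_inj; rewrite -[m.+1]card_ord -[m'.+1]card_ord.
  by rewrite -(card_imset _ d_inj) -(card_imset _ d'_inj) -/(image d) eq_im.
subst m'; congr existT.
have dK : ord_comp d (ord_comp (retraction d) d') = d'.
  by apply: retractionK_image; rewrite ?eq_im.
rewrite -[RHS]dK (@injective_endo _ (ord_comp _ d')) ?ord_comp1r // => i j eq_ij.
by apply: d'_inj; have := congr1 d eq_ij; rewrite -!ord_compE dK.
Qed.

Lemma notin_image m n (a : ordmap m n) (j : 'I_n.+1) :
  (forall i, a i != j :> nat) -> j \notin image a.
Proof. by move=> aj; apply/imageP => -[i ji]; have := aj i; rewrite ji eqxx. Qed.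

Lemma act_const (X : sset) m n (a : ordmap m n) k (x : X k) (i : 'I_k.+1) :
  act a (act (ord_const n i) x) = act (ord_const m i) x.
Proof. by rewrite -act_comp; congr act; apply: ordmap_eqn => j; rewrite !ordmapE. Qed.

Lemma not_misses n (P : pred nat) (c : {set 'I_n.+1}) (i : 'I_n.+1) :
  ~~ misses P c -> P i -> i \in c.
Proof. by move=> nm Pi; apply: contraR nm => ic; apply/missesP; exists i. Qed.

Lemma not_meets n (P : pred nat) m (a : ordmap m n) i :
  ~~ meets P (image a) -> ~~ P (a i).
Proof. by apply: contra => Pi; apply/meetsP; exists (a i); rewrite ?mem_image. Qed.

Lemma notin_image_neq n m (a : ordmap m n) (j : 'I_n.+1) i :
  j \notin image a -> a i != j :> nat.
Proof. by apply: contra => /eqP/ord_inj <-; apply: mem_image. Qed.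

Lemma notin_neq n (c : {set 'I_n.+1}) (i j : 'I_n.+1) :
  i \in c -> j \notin c -> i != j :> nat.
Proof. by move=> ic; apply: contraNN => /eqP/ord_inj <-. Qed.

(** The notions of cocartesian edge in play differ only in the simplices [v] tested: those with thin
    outer triangle in the scaled case, the degenerate simplices [squash] on the image of [e] in the
    local case, and those of the form [act b s] with prescribed first edge after base change along
    [s]. *)
Definition cocartesian_over (X S : sset) (f : smap X S) (e : X 1) n (v : S n.+2) :=
  forall phi, partial_lift f v (horn_faces ord0) phi ->
    phi 1 (first_edge n.+1) = e -> fills f ord0 v phi.

Definition cartesian_over (X S : sset) (f : smap X S) (e : X 1) n (v : S n.+2) :=
  forall phi, partial_lift f v (horn_faces ord_max) phi ->
    phi 1 (last_edge n.+1) = e -> fills f ord_max v phi.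

(** * Moving intermediate vertices: reduction to the outer triangle *)

Lemma degeneracy_le j : {homo (fun i => i - (j <= i)) : i k / i <= k}.
Proof. by move=> i k /=; lia. Qed.

Lemma shift_le j : {homo (fun i => i - (i == j)) : i k / i <= k}.
Proof. by move=> i k /=; lia. Qed.

Lemma bump_le j : {homo bump j : i k / i <= k}.
Proof. by move=> i k /=; rewrite leq_bump2. Qed.

(** The step in which a cocartesian edge is spent. New faces agree with [image d] away from
    [d ord0], so there is a single pair to add: the face of [d] and its facet opposite to the
    initial vertex. *)
Lemma extend_along_face (X S : sset) (f : smap X S) (e : X 1) N (v : S N) n
  (d : ordmap n.+2 N) (K L : pred {set 'I_N.+1}) (phi : simp_family X N) :
  injective d -> down_closed K -> down_closed L -> subpred K L ->
  L (image d) -> ~~ K (image d :\ d ord0) ->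
  (forall c, L c -> ~~ K c -> forall i, i != d ord0 -> (i \in c) = (i \in image d)) ->
  cocartesian_over f e (act d v) ->
  K (image (ord_comp d (first_edge n.+1))) ->
  phi 1 (ord_comp d (first_edge n.+1)) = e ->
  partial_lift f v K phi ->
  exists2 psi, partial_lift f v L psi & agree_on K psi phi.
Proof.
move=> d_inj K_down L_down KL Ld nKd LK e_cocart K_edge phi_edge phi_lift.
have LKd c : L c -> ~~ K c -> d ord0 \in c -> c = image d.
  move=> Lc nKc c0; apply/setP => i; have [->|i0] := eqVneq i (d ord0).
    by rewrite c0 mem_image.
  exact: LK.
have LKd0 c : L c -> ~~ K c -> c :\ d ord0 = image d :\ d ord0.
  move=> Lc nKc; apply/setP => i; rewrite !in_setD1; case: eqVneq => //= i0.
  exact: LK.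
apply: (@extend_along_horns _ _ f N v (d ord0) K L phi) => //.
  move=> c Lc nKc; rewrite LKd0 // nKd andbT.
  suff -> : d ord0 |: c = image d by [].
  apply/setP => i; rewrite in_setU1; have [->|i0] := eqVneq; first by rewrite mem_image.
  exact: LK.
move=> psi psiE m d' i d'_inj d'i Ld' nKd'.
have eq_im : image d = image d' by rewrite [RHS]LKd // -d'i mem_image.
pose R (s : {k & ordmap k N}) := forall i : 'I_(tag s).+1, tagged s i = d ord0 ->
  partial_lift f (act (tagged s) v) (horn_faces i) (pull (tagged s) psi) ->
  fills f i (act (tagged s) v) (pull (tagged s) psi).
suff : R (existT _ _ d') by apply.
rewrite -(face_unique d_inj d'_inj eq_im) => {m d' i d'_inj d'i Ld' nKd' eq_im} i /= /d_inj ->.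
by move/e_cocart; apply; rewrite /pull psiE.
Qed.

Lemma cocartesian_over_shift (X S : sset) (f : smap X S) (e : X 1) n (v : S n.+2) j :
  inner_fibration f -> 2 <= j < n.+2 ->
  cocartesian_over f e (act (nat_ordmap n.+2 n.+2 (@shift_le j)) v) ->
  cocartesian_over f e v.
Proof.
move=> f_inner j_bd e_cocart H H_lift He.
(* The vertices of Delta^{n.+3} are 0, ..., j - 1, j', j, ..., n.+2, with j' over
   j - 1.  First complete the faces containing j' that H determines, then use
   the hypothesis on the face omitting j, and finally recover the one omitting j'. *)
pose s := nat_ordmap n.+3 n.+2 (@degeneracy_le j).
have sE (i : 'I_n.+4) : s i = i - (j <= i) :> nat by rewrite nat_ordmapE; have := ltn_ord i; lia.
pose tj : 'I_n.+4 := inord j; pose tj1 : 'I_n.+4 := inord j.+1.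
have tjE : tj = j :> nat by rewrite inordK; lia.
have tj1E : tj1 = j.+1 :> nat by rewrite inordK; lia.
(* The inserted j' is numbered [j], and the old vertex j is numbered [j.+1]; [P] keeps the vertices
   other than 0 and these two. [K0] consists of the faces without the last vertex and of the horn on
   the face omitting j'. *)
pose P (k : nat) := [&& k != 0, k != j & k != j.+1].
pose K0 (c : {set 'I_n.+4}) := (ord_max \notin c) || (tj \notin c) && (misses P c || (tj1 \notin c)).
pose L1 (c : {set 'I_n.+4}) := K0 c || misses P c.
pose L2 (c : {set 'I_n.+4}) := L1 c || (tj1 \notin c).
have Pmax : P n.+3 by rewrite /P; lia.
have eqs : ((tj == tj1) = false) * ((tj1 == tj) = false) * ((ord_max == tj) = false) *
  ((ord_max == tj1) = false) * ((ord0 == tj) = false) * ((ord0 == tj1) = false) *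
  ((tj == ord0) = false) * ((tj1 == ord0) = false) * ((ord_max == ord0 :> 'I_n.+4) = false).
  do !split; apply/negbTE; rewrite -val_eqE /= ?tjE ?tj1E; lia.
have K0_down : down_closed K0 by down_closed_tac.
have L1_down : down_closed L1 by down_closed_tac.
have L2_down : down_closed L2 by down_closed_tac.
have lift0 : partial_lift f (act s v) K0 (pull s H).
  apply: pull_lift H_lift _ => c K0c; apply/horn_facesP.
  (* For [s] to send [c] into the horn, some nonzero value [s i] must be missed: [i] is outside [c]
     and no vertex of [c] has the same image. *)
  have [i [i0 ic iP]] : exists i : 'I_n.+4, [/\ i - (j <= i) != 0, i \notin c &
      forall k : 'I_n.+4, k \in c -> k != i -> k - (j <= k) != i - (j <= i)].
    have neq (k l : 'I_n.+4) : (k == l) = (k == l :> nat) by [].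
    case/orP: K0c => [mc|/andP[jc /orP[/missesP[k /and3P[k0 kj kj1] kc]|j1c]]].
    - by exists ord_max; split=> // [|k _]; rewrite ?neq /=; [lia | have := ltn_ord k; lia].
    - exists k; split=> // [|l lc]; first by lia.
      by have := memPn jc l lc; rewrite !neq tjE; lia.
    - exists tj1; split=> // [|l lc]; rewrite tj1E; first by lia.
      by have := memPn jc l lc; rewrite !neq tjE tj1E; lia.
  exists (s i); first by rewrite -val_eqE /= sE.
  apply/imsetP => -[k kc /(congr1 val) /=]; rewrite !sE => /esym/eqP.
  by apply/negP/iP => //; apply: contraNneq ic => <-.
(* Inner at [tj1]: the new faces contain [tj] before it and the last vertex after it, the latter
   being distinct from [tj1] because [j < n.+2]. *)
have [||||Phi1 Phi1_lift Phi1E] := extend_inner (t := tj1) (L := L1) f_inner _ _ _ _ lift0.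
- exact: K0_down.
- exact: L1_down.
- by move=> c; rewrite /L1 => ->.
- move=> c; rewrite /L1 /K0 !in_setU1 !in_setD1 !eqs misses_setU1 ?misses_setD1; last first.
  + by rewrite /P tj1E; lia.
  + by rewrite /P tj1E; lia.
  rewrite eqxx => Lc nKc; split; first by move: Lc nKc; bool_cases.
  + by move: Lc nKc; bool_cases.
  + by exists tj; [move: Lc nKc; bool_cases | rewrite tjE tj1E].
  by exists ord_max; [move: Lc nKc; bool_cases | rewrite tj1E /=; lia].
(* On the face omitting [tj1] the vertex j' stands in for j, and [s] composed with [d] is the shift
   of the hypothesis. *)
pose d := nat_ordmap n.+2 n.+3 (@bump_le j.+1).
have dE (k : 'I_n.+3) : d k = bump j.+1 k :> nat.
  by rewrite nat_ordmapE /bump; have := ltn_ord k; lia.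
have d_inj : injective d.
  by move=> k l /(congr1 (@nat_of_ord _)); rewrite !dE /bump => eq_d; apply: ord_inj; lia.
have d0 : d ord0 = ord0 by apply: ord_inj; rewrite dE.
have dP (k : 'I_n.+4) : (k \in image d) = (k != j.+1 :> nat).
  apply/imageP/idP => [[l ->]|kj]; first by rewrite dE eq_sym neq_bump.
  have l_lt : unbump j.+1 k < n.+3 by rewrite /unbump; have := ltn_ord k; lia.
  by exists (Ordinal l_lt); apply: ord_inj; rewrite dE /= unbumpKcond (negbTE kj).
have K0_edge : K0 (image (ord_comp d (first_edge n.+1))).
  apply/orP; left; apply: notin_image => i.
  by rewrite ord_compE dE first_edgeE /bump /=; have := ltn_ord i; lia.
have [|||||||Phi2 Phi2_lift Phi2E] := extend_along_face (e := e) (L := L2) d_inj L1_down L2_down _ _ _ _ _ _ _ Phi1_lift.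
- by move=> c Lc; apply/orP; left.
- by apply/orP; right; rewrite dP tj1E eqxx.
- have nMd : ~~ misses P (image d :\ d ord0).
    apply/negP => /missesP[k /and3P[k0 _ kj1]].
    by rewrite d0 in_setD1 dP kj1 andbT negbK => /eqP k_0; rewrite k_0 in k0.
  have d_max : ord_max \in image d :\ d ord0 by apply: not_misses nMd _.
  have dj : tj \in image d :\ d ord0.
    by rewrite d0 in_setD1 dP tjE -val_eqE /= tjE; lia.
  by rewrite /L1 /K0 d_max dj (negbTE nMd).
- move=> c; rewrite /L2 /L1 /K0 => Lc nLc i; rewrite d0 -val_eqE dP /= => i0.
  have nMc : ~~ misses P c by move: Lc nLc; bool_cases.
  have cj : tj \in c by move: Lc nLc; bool_cases.
  have cj1 : tj1 \notin c by move: Lc nLc; bool_cases.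
  have [ij1|ij1] := eqVneq (i : nat) j.+1.
    by apply: contraNF cj1; congr (_ \in c); apply: ord_inj; rewrite tj1E.
  have [ij|ij] := eqVneq (i : nat) j.
    by move: cj; congr (_ \in c); apply: ord_inj; rewrite tjE.
  by apply: not_misses nMc _; apply/and3P.
- have -> : act d (act s v) = act (nat_ordmap n.+2 n.+2 (@shift_le j)) v; last by [].
  rewrite -act_comp; congr act; apply: ordmap_eqn => i.
  by rewrite ord_compE sE dE nat_ordmapE /bump; have := ltn_ord i; lia.
- by rewrite /L1 K0_edge.
- rewrite Phi1E // /pull ord_compA -He; congr H; apply: ordmap_eqn => i.
  by rewrite !ord_compE sE dE first_edgeE /bump; have := ltn_ord i; lia.
(* Inner at [tj]: [2 <= j] puts the vertex 1 before it, and [tj1] comes after it. The facet opposite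
   to [tj] is the filler looked for. *)
have [||||Phi3 Phi3_lift Phi3E] := extend_inner (t := tj) (L := xpredT) f_inner _ _ _ _ Phi2_lift.
- exact: L2_down.
- by [].
- by [].
- move=> c _; rewrite /L2 /L1 /K0 !in_setD1 !eqs misses_setD1; last first.
  + by rewrite /P tjE; lia.
  rewrite eqxx => nKc; split=> //; first by move: nKc; bool_cases.
    have nMc : ~~ misses P c by move: nKc; bool_cases.
    have one_lt : 1 < n.+4 by [].
    exists (Ordinal one_lt); last by rewrite tjE /=; lia.
    by apply: contraR nMc => h; apply/missesP; exists (Ordinal one_lt); rewrite // /P /=; lia.
  by exists tj1; [move: nKc; bool_cases | rewrite tj1E tjE].
pose b := nat_ordmap n.+2 n.+3 (@bump_le j).
have bE (k : 'I_n.+3) : b k = bump j k :> nat.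
  by rewrite nat_ordmapE /bump; have := ltn_ord k; lia.
have sbK : ord_comp s b = ord_id _.
  by apply: ordmap_eqn => k; rewrite !ordmapE /bump; have := ltn_ord k; lia.
exists (Phi3 _ b); first by rewrite (proj2 Phi3_lift) // -act_comp sbK act_id.
move=> m a /horn_facesP[k k0 ka].
have K0ba : K0 (image (ord_comp b a)).
  apply/orP; right; apply/andP; split.
    by apply: notin_image => l; rewrite ord_compE bE tjE /bump; lia.
  have bk : b k \notin image (ord_comp b a).
    apply: contra ka => /imageP[l /(congr1 (@nat_of_ord _))]; rewrite ord_compE !bE => eq_k.
    have -> : k = a l by apply: ord_inj; move: eq_k; rewrite /bump; lia.
    exact: mem_image.
  have [Pbk|] := boolP (P (b k)); first by apply/orP; left; apply/missesP; exists (b k).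
  move=> nPbk; have <- : b k = tj1; last by rewrite bk orbT.
  apply: ord_inj; rewrite tj1E; move: nPbk k0; rewrite /P bE -val_eqE /= /bump; lia.
rewrite -(proj1 Phi3_lift) // Phi3E ?Phi2E ?Phi1E /L2 /L1 ?K0ba //.
by rewrite /pull ord_compA sbK ord_comp1.
Qed.

Lemma outer_triangle_le n : {homo (fun i => if i <= 1 then i else n.+2) : i k / i <= k}.
Proof. by move=> i k /= ik; case: (leqP i 1) => ?; case: (leqP k 1) => ?; lia. Qed.

Definition outer_triangle n : ordmap 2 n.+2 :=
  nat_ordmap _ _ (@outer_triangle_le n).

Lemma fold_le n : {homo (fun i => if i <= n.+1 then minn i 1 else 2) : i k / i <= k}.
Proof. by move=> i k /= ik; case: (leqP i n.+1) => ?; case: (leqP k n.+1) => ?; lia. Qed.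

(* The map [n.+2] -> [2] with values 0, 1, ..., 1, 2. *)
Definition fold n : ordmap n.+2 2 := nat_ordmap _ _ (@fold_le n).

Lemma merge_le j : {homo (fun i => if i <= j then minn i 1 else i) : i k / i <= k}.
Proof. by move=> i k /= ik; case: (leqP i j) => ?; case: (leqP k j) => ?; lia. Qed.

(** The map of [merge_le j] sends 1, ..., j to 1. It is the identity for [j = 0], it is [fold]
    followed by [outer_triangle] for [j = n.+1], and passing from [j] to [j.+1] precomposes it with
    the shift of [j.+1]. The shift lemma is therefore iterated. *)
Lemma cocartesian_over_fold (X S : sset) (f : smap X S) (e : X 1) n (v : S n.+2) :
  inner_fibration f ->
  cocartesian_over f e (act (fold n) (act (outer_triangle n) v)) ->
  cocartesian_over f e v.
Proof.
move=> f_inner; set w := act _ (act _ _).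
have -> : w = act (nat_ordmap n.+2 n.+2 (@merge_le n.+1)) v.
  rewrite /w -act_comp; congr act; apply: ordmap_eqn => i; rewrite !ordmapE.
  by have := ltn_ord i; case: (leqP i n.+1) => i_le; case: (leqP _ 1) => ?; lia.
suff main j : j < n.+2 -> cocartesian_over f e (act (nat_ordmap n.+2 n.+2 (@merge_le j)) v) ->
  cocartesian_over f e v by exact: main.
elim: j => [|j IH] j_lt.
  have -> : nat_ordmap n.+2 n.+2 (@merge_le 0) = ord_id _; last by rewrite act_id.
  by apply: ordmap_eqn => i; rewrite !ordmapE; have := ltn_ord i; case: (leqP i 0) => ?; lia.
move=> e_cocart; apply: (IH (ltnW j_lt)).
(* The shift lemma needs [2 <= j.+1]; for [j = 0] both merging maps are the identity. *)
have [j0|j_gt0] := posnP j.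
  move: e_cocart; rewrite j0; congr (cocartesian_over _ _ (act _ _)).
  by apply: ordmap_eqn => i; rewrite !ordmapE; have := ltn_ord i; case: (leqP i 0) => ?; case: (leqP i 1) => ?; lia.
apply: (cocartesian_over_shift (j := j.+1)) => //; first by rewrite ltnS j_gt0.
rewrite -act_comp; move: e_cocart; congr (cocartesian_over _ _ (act _ _)).
apply: ordmap_eqn => i; rewrite !ordmapE; have := ltn_ord i.
by case: (leqP i j.+1) => ?; case: (leqP _ j) => ?; lia.
Qed.

(** * Degenerate edges over a constant simplex *)

Lemma indicator_le k : {homo (fun i => nat_of_bool (k < i)) : i j / i <= j}.
Proof. by move=> i j /=; lia. Qed.

Lemma horn_edge (X S : sset) (f : smap X S) n (v : S n.+2) (phi : simp_family X n.+2)
  m (a : ordmap m n.+2) :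
  partial_lift f v (horn_faces ord0) phi -> (forall i, a i <= 1) ->
  phi m a = act (ord_comp (nat_ordmap n.+2 1 (@indicator_le 0)) a)
                (phi 1 (first_edge n.+1)).
Proof.
move=> [phi_nat _] a_le; rewrite -phi_nat.
  congr phi; apply: ordmap_eqn => i; rewrite !ordmapE.
  by have := a_le i; lia.
by apply/horn_facesP; exists (vtx (n.+3) 2) => //; apply: notin_image => i; rewrite ordmapE /=; have := ltn_ord i; lia.
Qed.

Lemma collapse_a_le : {homo (fun i => if i <= 2 then 0 else i - 2) : i j / i <= j}.
Proof. by move=> i j /= ij; case: (leqP i 2) => ?; case: (leqP j 2) => ?; lia. Qed.

Lemma collapse_b_le : {homo (fun i => if i <= 3 then 1 else i - 2) : i j / i <= j}.
Proof. by move=> i j /= ij; case: (leqP i 3) => ?; case: (leqP j 3) => ?; lia. Qed.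

Lemma collapse_c_le : {homo (fun i => if i <= 3 then 1 else i) : i j / i <= j}.
Proof. by move=> i j /= ij; case: (leqP i 3) => ?; case: (leqP j 3) => ?; lia. Qed.

Lemma skip12_le : {homo (fun i => if i == 0 then 0 else i + 2) : i j / i <= j}.
Proof. by move=> i j /= ij; case: (eqVneq i 0) => ?; case: (eqVneq j 0) => ?; lia. Qed.

Lemma horn_faces_pull m n (d : ordmap m n) i (c : {set 'I_m.+1}) (j : 'I_n.+1) :
  j != i -> (forall k, k \in c -> d k <> j :> nat) -> horn_faces i (d @: c).
Proof.
move=> ji dj; apply/horn_facesP; exists j => //.
by apply/imsetP => -[k /dj kc jk]; apply: kc; rewrite jk.
Qed.

Lemma cocartesian_over_degenerate (X S : sset) (f : smap X S) n (x : X 0) :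
  inner_fibration f ->
  cocartesian_over f (act (ord_const 1 ord0) x) (act (ord_const n.+2 ord0) (f 0 x)).
Proof.
move=> f_inner H H_lift He.
(* Joyal's argument: with vertices a0, b1, a2, b3 and V = {4, ...}, the horn H sits
   on (a2, b3, V).  The edge (b1, a2) is a one-sided inverse of (a2, b3) under V, and
   (a0, b1) one of (b1, a2); lifting these inverses produces (b1, V), which is
   copied to (b3, V), and then (a0, b3, V). *)
pose pa := nat_ordmap n.+4 n.+2 collapse_a_le.
pose pb := nat_ordmap n.+4 n.+2 collapse_b_le.
pose pc := nat_ordmap n.+4 n.+4 collapse_c_le.
have paE (i : 'I_n.+4.+1) : pa i = (if i <= 2 then 0 else i - 2) :> nat.
  by rewrite nat_ordmapE; have := ltn_ord i; case: (leqP i 2) => ?; lia.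
have pbE (i : 'I_n.+4.+1) : pb i = (if i <= 3 then 1 else i - 2) :> nat.
  by rewrite nat_ordmapE; have := ltn_ord i; case: (leqP i 3) => ?; lia.
pose P := leq 4.
(* Via [pa], which sends a0 and a2 to 0, [A] prescribes [H] on (a0, b3, V) as well as on (a2, b3,
   V). Via [pb], [B] prescribes it on b1, b3 and proper parts of V. [C] is the tetrahedron (a0, b1,
   a2, b3), constant at [x] because the first edge of [H] is degenerate. *)
pose A (c : {set 'I_n.+4.+1}) := (vtx (n.+4.+1) 1 \notin c) && (misses P c || (vtx (n.+4.+1) 3 \notin c)).
pose B (c : {set 'I_n.+4.+1}) := [&& vtx (n.+4.+1) 0 \notin c, vtx (n.+4.+1) 2 \notin c & misses P c].
pose C (c : {set 'I_n.+4.+1}) := ~~ meets P c.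
pose K0 c := C c || (A c || B c).
pose L1 c := K0 c || (vtx (n.+4.+1) 0 \notin c) && misses P c.
pose L2 c := L1 c || misses P c.
pose L3 c := L2 c || (vtx (n.+4.+1) 3 \notin c).
pose D (c : {set 'I_n.+4.+1}) := (vtx (n.+4.+1) 0 \notin c) && (vtx (n.+4.+1) 2 \notin c).
pose L4 c := L3 c || D c.
pose L5 c := L4 c || (vtx (n.+4.+1) 2 \notin c).
have A_down : down_closed A by down_closed_tac.
have B_down : down_closed B by down_closed_tac.
have C_down : down_closed C by down_closed_tac.
have AB_down : down_closed (predU A B) by apply: down_closedU.
have K0_down : down_closed K0 by apply: down_closedU.
have L1_down : down_closed L1 by down_closed_tac.
have L2_down : down_closed L2 by down_closed_tac.
have L3_down : down_closed L3 by down_closed_tac.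
have D_down : down_closed D by down_closed_tac.
have L4_down : down_closed L4 by apply: down_closedU.
have L5_down : down_closed L5 by down_closed_tac.
set v := act _ (f 0 x) in H_lift *.
pose v' := act (ord_const n.+4 ord0) (f 0 x).
have avE (d : ordmap n.+4 n.+2) : act d v = v' by rewrite act_const.
have A_lift : partial_lift f v' A (pull pa H).
  rewrite -(avE pa); apply: pull_lift H_lift _ => c /andP[c1 /orP[/missesP[k Pk kc]|c3]].
    have := ltn_ord k; move: Pk; rewrite /P => *.
    apply: (horn_faces_pull (j := pa k)) => [|l /notin_neq/(_ kc)]; rewrite ?paE.
      by rewrite -val_eqE /= paE; case: (leqP k 2) => ?; lia.
    by case: (leqP k 2) => ?; case: (leqP l 2) => ?; lia.
  apply: (horn_faces_pull (j := vtx (n.+3) 1)) => // l /notin_neq/(_ c3); rewrite paE /=.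
  by case: (leqP l 2) => ?; lia.
have B_lift : partial_lift f v' B (pull pb H).
  rewrite -(avE pb); apply: pull_lift H_lift _ => c /and3P[c0 c2 /missesP[k Pk kc]].
  have := ltn_ord k; move: Pk; rewrite /P => *.
  apply: (horn_faces_pull (j := pb k)) => [|l /notin_neq/(_ kc)]; rewrite ?pbE.
    by rewrite -val_eqE /= pbE; case: (leqP k 3) => ?; lia.
  by case: (leqP k 3) => ?; case: (leqP l 3) => ?; lia.
have C_lift : partial_lift f v' C (fun m _ => act (ord_const m ord0) x).
  by split=> [l m a b|m a] _; rewrite act_const // smap_act.
have AB_agree : agree_on (predI A B) (pull pa H) (pull pb H).
  move=> m a /andP[/andP[a1 _] /and3P[a0 a2 _]]; rewrite /pull; congr H.
  apply: ordmap_eqn => i; rewrite !ord_compE paE pbE.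
  have := notin_image_neq i a0; have := notin_image_neq i a1.
  have := notin_image_neq i a2; rewrite /=.
  by case: (leqP (a i) 2) => ?; case: (leqP (a i) 3) => ?; lia.
have AB_lift := glued_lift A_down B_down AB_agree A_lift B_lift.
have CAB_agree : agree_on (predI C (predU A B)) (fun m _ => act (ord_const m ord0) x)
   (glued A (pull pa H) (pull pb H)).
  move=> m a /andP[Ca _]; have a_le i : a i <= 3.
    by have := not_meets i Ca; rewrite /P; lia.
  rewrite /glued /pull; case: ifP => _; rewrite (horn_edge H_lift) ?He ?act_const // => i.
    by rewrite ord_compE paE; case: ifP => //; have := a_le i; lia.
  by rewrite ord_compE pbE a_le.
have K0_lift := glued_lift C_down AB_down CAB_agree C_lift AB_lift.
have [||||Phi1 Phi1_lift Phi1E] := extend_inner (t := vtx (n.+4.+1) 3) (L := L1) f_inner _ _ _ _ K0_lift.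
- by [].
- by [].
- by move=> c Kc; apply/orP; left.
- move=> c; rewrite /L1 /K0 /A /B /C; rewrite /= !inE !misses_setU1 // !misses_setD1 // !meets_setU1 // !meets_setD1 // -!val_eqE /=.
  move=> Lc nKc; split.
  + by move: Lc nKc; bool_cases.
  + by move: Lc nKc; bool_cases.
  + by exists (vtx (n.+4.+1) 1); [move: Lc nKc; bool_cases |].
  have /meetsP[k Pk kc] : meets P c by move: nKc; bool_cases.
  by exists k => //; apply: leq_trans Pk.
have [||||Phi2 Phi2_lift Phi2E] := extend_inner (t := vtx (n.+4.+1) 2) (L := L2) f_inner _ _ _ _ Phi1_lift.
- by [].
- by [].
- by move=> c Kc; apply/orP; left.
- move=> c; rewrite /L2 /L1 /K0 /A /B /C; rewrite /= !inE !misses_setU1 // !misses_setD1 // !meets_setU1 // !meets_setD1 // -!val_eqE /=.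
  move=> Lc nKc; split.
  + by move: Lc nKc; bool_cases.
  + by move: Lc nKc; bool_cases.
  + by exists (vtx (n.+4.+1) 0); [move: Lc nKc; bool_cases |].
  have /meetsP[k Pk kc] : meets P c by move: nKc; bool_cases.
  by exists k => //; apply: leq_trans Pk.
(* The inner horn of (b1, a2, V) at a2 is now complete; filling it creates the facet (b1, V), which
   is the kind of face absent from [H]. *)
have [||||Phi3 Phi3_lift Phi3E] := extend_inner (t := vtx (n.+4.+1) 2) (L := L3) f_inner _ _ _ _ Phi2_lift.
- by [].
- by [].
- by move=> c Kc; apply/orP; left.
- move=> c; rewrite /L3 /L2 /L1 /K0 /A /B /C; rewrite /= !inE !misses_setU1 // !misses_setD1 // !meets_setU1 // !meets_setD1 // -!val_eqE /=.
  move=> Lc nKc; split.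
  + by move: Lc nKc; bool_cases.
  + by move: Lc nKc; bool_cases.
  + by exists (vtx (n.+4.+1) 1); [move: Lc nKc; bool_cases |].
  exists (vtx (n.+4.+1) 4) => //; apply: (@not_misses _ P) => //.
  by move: Lc nKc; bool_cases.
have Phi3AB m (a : ordmap m n.+4) : A (image a) || B (image a) ->
    Phi3 m a = glued A (pull pa H) (pull pb H) a.
  move=> ABa; have K0a : K0 (image a) by rewrite /K0 ABa orbT.
  have L1a : L1 (image a) by rewrite /L1 K0a.
  have L2a : L2 (image a) by rewrite /L2 L1a.
  by rewrite Phi3E // Phi2E // Phi1E // (glued_r CAB_agree).
have pcE (i : 'I_n.+4.+1) : pc i = (if i <= 3 then 1 else i) :> nat.
  by rewrite nat_ordmapE; have := ltn_ord i; case: (leqP i 3) => ?; lia.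
(* Since [pc] sends b3 to b1 and fixes V, a degenerate simplex on (b1, V) is put on (b1, b3, V). It
   agrees with what is known there, because [B] already treats b1 and b3 alike. *)
have D_lift : partial_lift f v' D (pull pc Phi3).
  have -> : v' = act pc v' by rewrite act_const.
  apply: pull_lift Phi3_lift _ => c _; apply/orP; right.
  apply/imsetP => -[k kc /(congr1 (@nat_of_ord _))]; rewrite pcE /=.
  by case: (leqP k 3) => ?; lia.
have L3D_agree : agree_on (predI L3 D) Phi3 (pull pc Phi3).
  move=> m a /andP[L3a Da]; have /andP[a0 a2] := Da.
  have [a3|a3] := boolP (vtx (n.+4.+1) 3 \in image a); last first.
    rewrite /pull; congr Phi3; apply: ordmap_eqn => i; rewrite !ord_compE pcE.
    have := notin_image_neq i a0; have := notin_image_neq i a2.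
    by have := notin_image_neq i a3; case: (leqP (a i) 3) => ?; rewrite /=; lia.
  have Ma : misses P (image a).
    have CM : C (image a) -> misses P (image a).
      move=> Ca; apply/missesP; exists (vtx (n.+4.+1) 4) => //; apply: contra Ca => a4.
      by apply/meetsP; exists (vtx (n.+4.+1) 4).
    move: L3a CM; rewrite /L3 /L2 /L1 /K0 /A /B a3.
    by case: (C _); bool_cases; move=> _ /(_ isT).
  have Ba : B (image a) by apply/and3P.
  have Bpa : B (image (ord_comp pc a)).
    apply/and3P; split.
    - by apply: notin_image => i; rewrite ord_compE pcE /=; case: (leqP (a i) 3) => // a_gt; apply: contraTneq a_gt => ->.
    - by apply: notin_image => i; rewrite ord_compE pcE /=; case: (leqP (a i) 3) => // a_gt; apply: contraTneq a_gt => ->.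
    have /missesP[k Pk ka] := Ma; apply/missesP; exists k => //; move: Pk; rewrite /P => Pk.
    apply: notin_image => i; have := notin_image_neq i ka.
    by rewrite ord_compE pcE; case: (leqP (a i) 3) => // _ _; apply: contraTneq Pk => <-.
  rewrite /pull !Phi3AB ?Ba ?Bpa ?orbT // !(glued_r AB_agree) // /pull ord_compA.
  congr H; apply: ordmap_eqn => i; rewrite !ord_compE !pbE pcE.
  by case: (leqP (a i) 3) => // a_gt; rewrite leqNgt a_gt.
have L4_lift := glued_lift L3_down D_down L3D_agree Phi3_lift D_lift.
(* Inner at b1, between a0 and b3. The facet (a0, b3, V) is a filler, as [A] prescribes [H] on its
   horn. *)
have [||||Phi5 Phi5_lift Phi5E] := extend_inner (t := vtx (n.+4.+1) 1) (L := L5) f_inner _ _ _ _ L4_lift.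
- by [].
- by [].
- by move=> c Kc; apply/orP; left.
- move=> c; rewrite /L5 /L4 /L3 /L2 /L1 /K0 /A /B /C /D; rewrite /= !inE !misses_setU1 // !misses_setD1 // !meets_setU1 // !meets_setD1 // -!val_eqE /=.
  move=> Lc nKc; split.
  + by move: Lc nKc; bool_cases.
  + by move: Lc nKc; bool_cases.
  + by exists (vtx (n.+4.+1) 0); [move: Lc nKc; bool_cases |].
  by exists (vtx (n.+4.+1) 3); [move: Lc nKc; bool_cases |].
pose b := nat_ordmap n.+2 n.+4 skip12_le.
have bE (i : 'I_n.+3) : b i = (if i == 0 :> nat then 0 else i + 2) :> nat.
  by rewrite nat_ordmapE; have := ltn_ord i; case: (eqVneq (i : nat) 0) => ?; lia.
have pabK : ord_comp pa b = ord_id _.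
  apply: ordmap_eqn => i; rewrite !ord_compE paE bE ord_idE.
  by case: (eqVneq (i : nat) 0) => ?; case: leqP => ?; lia.
have L5b : L5 (image b).
  apply/orP; right; apply: notin_image => i; rewrite bE.
  by case: (eqVneq (i : nat) 0) => // i0; rewrite addn2 !eqSS.
have L5ba m (a : ordmap m n.+2) : L5 (image (ord_comp b a)).
  by apply: L5_down (image_compS b a) L5b.
exists (Phi5 _ b); first by rewrite (proj2 Phi5_lift) ?act_const.
move=> m a /horn_facesP[k k0 ka].
have Aba : A (image (ord_comp b a)).
  apply/andP; split.
    by apply: notin_image => i; rewrite ord_compE bE; case: (eqVneq (a i : nat) 0) => //; rewrite addn2.
  have kba : b k \notin image (ord_comp b a).
    apply: notin_image => i; rewrite ord_compE; apply: contra ka => /eqP eq_b.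
    have -> : k = a i; last exact: mem_image.
    apply: ord_inj; have := congr1 (fun x => nat_of_ord (pa x)) (ord_inj eq_b).
    by rewrite -!(ord_compE pa b) pabK !ord_idE => ->.
  have [k1|k1] := eqVneq (k : nat) 1.
    have <- : b k = vtx (n.+4.+1) 3 by apply: ord_inj; rewrite bE k1.
    by rewrite kba orbT.
  apply/orP; left; apply/missesP; exists (b k) => //; move: k0 k1; rewrite bE -val_eqE /=.
  by case: (nat_of_ord k) => [|[|l]] //; rewrite addn2.
rewrite -(proj1 Phi5_lift) // Phi5E; last by rewrite /= /L3 /L2 /L1 /K0 Aba !orbT.
rewrite glued_l; last by rewrite /L3 /L2 /L1 /K0 Aba !orbT.
by rewrite Phi3AB ?Aba // glued_l // /pull ord_compA pabK ord_comp1.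
Qed.

(* The map [n.+2] -> [1] with values 0, 1, ..., 1. *)
Definition squash n : ordmap n.+2 1 := nat_ordmap n.+2 1 (@indicator_le 0).

Lemma squashE n (i : 'I_n.+3) : squash n i = (0 < i) :> nat.
Proof. by rewrite nat_ordmapE; case: (0 < i). Qed.

(** * Comparing locally cocartesian edges with the same source and image *)

Definition locally_cocartesian_over (X S : sset) (f : smap X S) (e : X 1) :=
  forall n, cocartesian_over f e (act (squash n) (f 1 e)).

(** The edges [e] and [e'] form a horn at their common source, over the degenerate triangle on their
    image. The last edge of the filler compares the target of [e] with that of [e']. *)
Lemma comparison_triangle (X S : sset) (f : smap X S) (e e' : X 1) :
  locally_cocartesian_over f e -> source e = source e' -> f 1 e = f 1 e' ->
  exists t : X 2, [/\ f 2 t = act (squash 0) (f 1 e),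
    forall m (a : ordmap m 2), ord_max \notin image a -> act a t = act (ord_comp (squash 0) a) e &
    forall m (a : ordmap m 2), vtx 3 1 \notin image a -> act a t = act (ord_comp (squash 0) a) e'].
Proof.
move=> e_cocart src_eq fe_eq.
pose K (c : {set 'I_3}) := ord_max \notin c; pose L (c : {set 'I_3}) := vtx 3 1 \notin c.
have sub : subpred (horn_faces ord0) (predU K L).
  by move=> c /horn_facesP[[[|[|[|//]]] lt_i] // _ ic]; apply/orP; [right|left];
     congr (~~ (_ \in c)): ic; apply: ord_inj.
pose phi (x : X 1) : simp_family X 2 := fun m a => act (ord_comp (squash 0) a) x.
have phi_lift (P : pred {set 'I_3}) x : f 1 x = f 1 e -> partial_lift f (act (squash 0) (f 1 e)) P (phi x).
  by move=> fx; split=> [l m a b|m a] _; rewrite /phi ?ord_compA ?act_comp ?smap_act ?fx.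
have agr : agree_on (predI K L) (phi e) (phi e').
  move=> m a /andP[Ka La]; rewrite /phi.
  have -> : ord_comp (squash 0) a = ord_comp (ord_const 0 ord0) (ord_const m ord0).
    apply: ordmap_eqn => i; rewrite !ord_compE squashE ord_constE.
    have := notin_image_neq i Ka; have := notin_image_neq i La.
    by case: (a i) => -[|[|[|]]].
  by rewrite !act_comp; congr act.
have K_down : down_closed K by down_closed_tac.
have L_down : down_closed L by down_closed_tac.
have := glued_lift K_down L_down agr (phi_lift _ _ erefl) (phi_lift _ _ (esym fe_eq)).
case/lift_sub/(_ sub)/e_cocart => [|t ft tP].
  rewrite glued_l; last by apply: notin_image => i; rewrite first_edgeE; have := ltn_ord i; rewrite /=; lia.
  by rewrite /phi -[RHS]act_id; congr act; apply: ordmap_eqn => -[[|[|//]] i]; rewrite ord_compE squashE first_edgeE ord_idE.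
exists t; split=> // m a a_no; rewrite -tP.
- exact: glued_l.
- by apply/horn_facesP; exists ord_max.
- exact: (glued_r agr).
- by apply/horn_facesP; exists (vtx 3 1).
Qed.

Lemma face_013_le : {homo (fun i => minn i 2) : i j / i <= j}.
Proof. by move=> i j /=; lia. Qed.

(* The 3-simplex (x, y, y', y) exhibiting g as a left inverse of h, for
   comparison triangles (x, y, y') of (e, h, e') and (x, y', y) of (e', g, e). *)
Lemma comparison_tetrahedron (X S : sset) (f : smap X S) (e e' : X 1) :
  locally_cocartesian_over f e -> locally_cocartesian_over f e' ->
  source e = source e' -> f 1 e = f 1 e' ->
  exists t : X 3, [/\ f 3 t = act (squash 1) (f 1 e),
    forall m (a : ordmap m 3), vtx 4 2 \notin image a ->
      act a t = act (ord_comp (squash 1) a) e &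
    forall m (a : ordmap m 3), vtx 4 1 \notin image a -> ord_max \notin image a ->
      act a t = act (ord_comp (squash 1) a) e'].
Proof.
move=> e_cocart e'_cocart src_eq fe_eq.
have [t [ft t_e t_e']] := comparison_triangle e_cocart src_eq fe_eq.
have [t' [ft' t'_e' t'_e]] := comparison_triangle e'_cocart (esym src_eq) (esym fe_eq).
pose p := nat_ordmap 3 2 face_013_le; pose p' := nat_ordmap 3 2 (@degeneracy_le 2).
(* The three facets through x: [K] is (x, y, y'), taken from [t]; [K'] is (x, y', y), taken from
   [t']; [K''] is (x, y, y), taken degenerate on [e]. The horn they form is filled because [e] is
   locally cocartesian. *)
pose K (c : {set 'I_4}) := ord_max \notin c.
pose K' (c : {set 'I_4}) := vtx 4 1 \notin c.
pose K'' (c : {set 'I_4}) := vtx 4 2 \notin c.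
pose phi : simp_family X 3 := fun m a => act (ord_comp p a) t.
pose phi' : simp_family X 3 := fun m a => act (ord_comp p' a) t'.
pose phi'' : simp_family X 3 := fun m a => act (ord_comp (squash 1) a) e.
have sq_p : ord_comp (squash 0) p = squash 1.
  by apply: ordmap_eqn => i; rewrite ord_compE !squashE nat_ordmapE; case: i => [[|[|[|[|]]]]].
have sq_p' : ord_comp (squash 0) p' = squash 1.
  by apply: ordmap_eqn => i; rewrite ord_compE !squashE nat_ordmapE; case: i => [[|[|[|[|]]]]].
have lift0 n k (q : ordmap 3 n) (x : X n) (P : pred {set 'I_4}) :
  f n x = act k (f 1 e) -> ord_comp k q = squash 1 ->
  partial_lift f (act (squash 1) (f 1 e)) P (fun m a => act (ord_comp q a) x).
  move=> fx kq; split=> [l m a b|m a] _; first by rewrite ord_compA act_comp.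
  by rewrite smap_act fx -!act_comp ord_compA kq.
have vals m (a : ordmap m 3) (i : 'I_m.+1) : a i <= 3 by rewrite -ltnS.
have K_down : down_closed K by down_closed_tac.
have K'_down : down_closed K' by down_closed_tac.
have K''_down : down_closed K'' by down_closed_tac.
have phi_lift P : partial_lift f (act (squash 1) (f 1 e)) P phi by apply: lift0 ft _.
have phi'_lift P : partial_lift f (act (squash 1) (f 1 e)) P phi'.
  by rewrite -fe_eq in ft'; apply: lift0 ft' _.
have phi''_lift P : partial_lift f (act (squash 1) (f 1 e)) P phi''.
  apply: (lift0 _ (ord_id 1) (squash 1) e); first by rewrite act_id.
  by rewrite ord_comp1.
have phi'_K'' : agree_on (predI K' K'') phi' phi''.
  move=> m a /andP[a1 a2]; rewrite /phi' t'_e ?ord_compA ?sq_p' //.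
  apply: notin_image => i; rewrite ord_compE nat_ordmapE /=.
  by have := notin_image_neq i a1; have := notin_image_neq i a2; rewrite /=; lia.
have phi_e m (a : ordmap m 3) : ord_max \notin image a -> vtx 4 2 \notin image a ->
    phi m a = act (ord_comp (squash 1) a) e.
  move=> a3 a2; rewrite /phi t_e ?ord_compA ?sq_p //.
  apply: notin_image => i; rewrite ord_compE nat_ordmapE /=.
  have := notin_image_neq i a3; have := notin_image_neq i a2; have := vals _ a i.
  by rewrite /=; lia.
have phi_e' m (a : ordmap m 3) : ord_max \notin image a -> vtx 4 1 \notin image a ->
    phi m a = act (ord_comp (squash 1) a) e'.
  move=> a3 a1; rewrite /phi t_e' ?ord_compA ?sq_p //.
  apply: notin_image => i; rewrite ord_compE nat_ordmapE /=.
  have := notin_image_neq i a3; have := notin_image_neq i a1; have := vals _ a i.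
  by rewrite /=; lia.
have agr : agree_on (predI K (predU K' K'')) phi (glued K' phi' phi'').
  move=> m a /andP[a3 /orP a12]; rewrite /glued; case: ifP => a1; last first.
    by case: a12 => [|a2]; [rewrite a1 | rewrite phi_e].
  rewrite phi_e' // /phi' t'_e' ?ord_compA ?sq_p' //.
  apply: notin_image => i; rewrite ord_compE nat_ordmapE /=.
  have := notin_image_neq i a3; have := notin_image_neq i a1; have := vals _ a i.
  by rewrite /=; lia.
have K'K''_down : down_closed (predU K' K'') by apply: down_closedU.
have lift' := glued_lift K'_down K''_down phi'_K'' (phi'_lift _) (phi''_lift _).
have := glued_lift K_down K'K''_down agr (phi_lift _) lift'.
have sub : subpred (horn_faces ord0) (predU K (predU K' K'')).
  move=> c /horn_facesP[[[|[|[|[|//]]]] lt_i] // _ ic]; apply/or3P;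
    [constructor 2 | constructor 3 | constructor 1]; congr (~~ (_ \in c)): ic;
    exact: ord_inj.
case/lift_sub/(_ sub)/e_cocart => [|T fT TP].
  have e3 : K (image (first_edge 2)).
    by apply: notin_image => i; rewrite first_edgeE; have := ltn_ord i; rewrite /=; lia.
  rewrite glued_l // phi_e //; last first.
    by apply: notin_image => i; rewrite first_edgeE; have := ltn_ord i; rewrite /=; lia.
  rewrite -[RHS]act_id; congr act; apply: ordmap_eqn => -[[|[|//]] i].
    by rewrite ord_compE squashE first_edgeE ord_idE.
  by rewrite ord_compE squashE first_edgeE ord_idE.
exists T; split=> // m a => [a2|a1 a3]; rewrite -TP.
- by rewrite (glued_r agr) ?(glued_r phi'_K'') //=; apply/orP; right.
- by apply/horn_facesP; exists (vtx 4 2).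
- by rewrite glued_l // phi_e'.
- by apply/horn_facesP; exists (vtx 4 1).
Qed.

Lemma collapse_123_le :
  {homo (fun i => if i <= 3 then nat_of_bool (0 < i) else i - 2) : i j / i <= j}.
Proof. by move=> i j /= ij; case: (leqP i 3) => ?; case: (leqP j 3) => ?; lia. Qed.

Lemma minn_le k : {homo minn^~ k : i j / i <= j}.
Proof. by move=> i j /=; lia. Qed.

Lemma skip13_le : {homo (fun i => if i == 0 then 0 else if i == 1 then 2 else i + 2) : i j / i <= j}.
Proof.
by move=> [|[|i]] [|[|j]] //=; rewrite ?addn2 // !ltnS => *; rewrite ltnW.
Qed.

Lemma skip23_le : {homo (fun i => if i <= 1 then i else i + 2) : i j / i <= j}.
Proof. by move=> i j /= ij; case: (leqP i 1) => ?; case: (leqP j 1) => ?; lia. Qed.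

Lemma cocartesian_over_comparison (X S : sset) (f : smap X S) (e e' : X 1) n (v : S n.+2) :
  inner_fibration f ->
  locally_cocartesian_over f e -> locally_cocartesian_over f e' ->
  source e = source e' -> f 1 e = f 1 e' ->
  cocartesian_over f e' v -> cocartesian_over f e v.
Proof.
move=> f_inner e_coc e'_coc src_eq fe_eq e'_v H H_lift He.
have [t [ft t_e t_e']] := comparison_tetrahedron e_coc e'_coc src_eq fe_eq.
(* On vertices 0, 1, 1', 1'', V: the first four span the tetrahedron t and
   (0, 1'', V) carries H.  The cocartesian lift is used on (0, 1', V). *)
have fe : f 1 e = act (first_edge n.+1) v.
  rewrite -He (proj2 H_lift) //; apply/horn_facesP; exists ord_max => //.
  by apply: notin_image => i; rewrite first_edgeE; have := ltn_ord i; rewrite /=; lia.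
pose p := nat_ordmap n.+4 n.+2 collapse_123_le.
pose q := nat_ordmap n.+4 3 (@minn_le 3).
have pE (i : 'I_n.+4.+1) : p i = (if i <= 3 then nat_of_bool (0 < i) else i - 2) :> nat.
  by rewrite nat_ordmapE; have := ltn_ord i; case: (leqP i 3) => ?; lia.
have qE (i : 'I_n.+4.+1) : q i = minn i 3 :> nat by rewrite nat_ordmapE; lia.
pose v' := act p v.
pose P := leq 4.
(* Both 1 and 1'' go to the vertex 1 under [p], so [A] prescribes [H] on (0, 1, V) as well as on (0,
   1'', V). *)
pose A (c : {set 'I_n.+4.+1}) := (vtx (n.+4.+1) 2 \notin c) &&
  (misses P c || (vtx (n.+4.+1) 1 \notin c) && (vtx (n.+4.+1) 3 \notin c)).
pose C (c : {set 'I_n.+4.+1}) := ~~ meets P c.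
pose K0 c := C c || A c.
pose L1 c := K0 c || misses P c.
pose L2 c := L1 c || (vtx (n.+4.+1) 1 \notin c) && (vtx (n.+4.+1) 3 \notin c).
pose L3 c := L2 c || (vtx (n.+4.+1) 3 \notin c).
have A_down : down_closed A by down_closed_tac.
have C_down : down_closed C by down_closed_tac.
have K0_down : down_closed K0 by down_closed_tac.
have L1_down : down_closed L1 by down_closed_tac.
have L2_down : down_closed L2 by down_closed_tac.
have L3_down : down_closed L3 by down_closed_tac.
have A_lift : partial_lift f v' A (pull p H).
  apply: pull_lift H_lift _ => c /andP[c2 /orP[/missesP[k Pk kc]|/andP[c1 c3]]].
    have := ltn_ord k; move: Pk; rewrite /P => *.
    apply: (horn_faces_pull (j := p k)) => [|l /notin_neq/(_ kc)]; rewrite ?pE.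
      by rewrite -val_eqE /= pE; case: (leqP k 3) => ?; lia.
    by case: (leqP k 3) => ?; case: (leqP l 3) => ?; lia.
  apply: (horn_faces_pull (j := vtx (n.+3) 1)) => // l lc; rewrite pE /=.
  have := notin_neq lc c1; have := notin_neq lc c2; have := notin_neq lc c3.
  by case: (leqP l 3) => ?; rewrite /=; lia.
pose phi : simp_family X n.+4 := fun m a => act (ord_comp q a) t.
have Cle m (a : ordmap m n.+4) i : C (image a) -> a i <= 3.
  by move=> Ca; have := not_meets i Ca; rewrite /P; lia.
have C_lift : partial_lift f v' C phi.
  split=> [l m a b|m a] Ca; first by rewrite /phi ord_compA act_comp.
  rewrite /phi smap_act ft fe -!act_comp; congr act; apply: ordmap_eqn => i.
  rewrite !ord_compE first_edgeE squashE qE pE Cle //.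
  by rewrite leq_min andbT.
(* Here the left inverse enters: the face of [t] omitting 1' is degenerate on [e], and so is [H] on
   the corresponding vertices. *)
have agr : agree_on (predI C A) phi (pull p H).
  move=> m a /andP[Ca /andP[a2 _]]; rewrite /phi t_e; last first.
    apply: notin_image => i; rewrite ord_compE qE.
    by have := notin_image_neq i a2; rewrite /=; lia.
  rewrite /pull (horn_edge H_lift) ?He => [|i]; last first.
    by rewrite ord_compE pE Cle //; case: (0 < _).
  congr act; apply: ordmap_eqn => i; rewrite !ord_compE squashE nat_ordmapE qE pE Cle //.
  by rewrite leq_min andbT; case: (0 < a i).
have K0_lift := glued_lift C_down A_down agr C_lift A_lift.
(* Inner at 1'', between 1' and V. This carries the part of [H] on proper subsets of V over to 1',
   giving a horn on (0, 1', V) with first edge [e']. *)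
have [||||Phi1 Phi1_lift Phi1E] := extend_inner (t := vtx (n.+4.+1) 3) (L := L1) f_inner _ _ _ _ K0_lift.
- by [].
- by [].
- by move=> c Kc; apply/orP; left.
- move=> c; rewrite /L1 /K0 /A /C /= !inE !misses_setU1 // !misses_setD1 // !meets_setU1 // !meets_setD1 // -!val_eqE /=.
  move=> Lc nKc; split.
  + by move: Lc nKc; bool_cases.
  + by move: Lc nKc; bool_cases.
  + by exists (vtx (n.+4.+1) 2); [move: Lc nKc; bool_cases |].
  have /meetsP[k Pk kc] : meets P c by move: nKc; bool_cases.
  by exists k => //; apply: leq_trans Pk.
pose d := nat_ordmap n.+2 n.+4 skip13_le.
have dE (i : 'I_n.+3) : d i = (if i == 0 :> nat then 0 else if i == 1 :> nat then 2 else i + 2) :> nat.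
  rewrite nat_ordmapE; have := ltn_ord i; case: (nat_of_ord i) => [|[|k]] //= *; lia.
have pdK : ord_comp p d = ord_id _.
  apply: ordmap_eqn => i; rewrite !ord_compE pE dE ord_idE.
  by case: (nat_of_ord i) => [|[|k]] //=; rewrite !addn2 /= subn2.
have d_inj : injective d.
  by move=> i j /(congr1 p); rewrite -!(ord_compE p d) pdK !ord_idE.
have d0 : d ord0 = ord0 by apply: ord_inj; rewrite dE.
have dP (k : 'I_n.+4.+1) : (k \in image d) = [|| k == 0 :> nat, k == 2 :> nat | 4 <= k].
  apply/imageP/idP => [[i ->]|k_d].
    by rewrite dE; case: (nat_of_ord i) => [|[|l]] //=; rewrite !addn2.
  exists (p k); apply: ord_inj; rewrite dE pE.
  by case: (nat_of_ord k) k_d => [|[|[|[|l]]]] //= _; rewrite subn2 addn2.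
have Phi1C m (a : ordmap m n.+4) : C (image a) -> Phi1 m a = act (ord_comp q a) t.
  by move=> Ca; rewrite Phi1E ?glued_l //= Ca.
have d_edgeC : C (image (ord_comp d (first_edge n.+1))).
  apply/negP => /meetsP[k Pk /imageP[i ki]]; move: Pk; rewrite ki ord_compE dE first_edgeE /P.
  by case: i ki => -[|[|]].
have [|||||||Phi2 Phi2_lift Phi2E] := extend_along_face (e := e') (L := L2) d_inj L1_down L2_down _ _ _ _ _ _ _ Phi1_lift.
- by move=> c Lc; apply/orP; left.
- apply/orP; right; apply/andP; split; apply: notin_image => i; rewrite dE.
  + by case: (nat_of_ord i) => [|[|k]] //=; rewrite addn2.
  + by case: (nat_of_ord i) => [|[|k]] //=; rewrite addn2.
- have nMd : ~~ misses P (image d :\ d ord0).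
    apply/negP => /missesP[k Pk]; rewrite d0 in_setD1 dP -val_eqE /=.
    by move: Pk; rewrite /P => Pk; rewrite Pk !orbT andbT negbK => /eqP k0; rewrite k0 in Pk.
  have Cd : meets P (image d :\ d ord0).
    by apply/meetsP; exists (vtx (n.+4.+1) 4); rewrite // d0 in_setD1 dP.
  have d2 : vtx (n.+4.+1) 2 \in image d :\ d ord0 by rewrite d0 in_setD1 dP.
  by rewrite /L1 /K0 /A /C Cd d2 (negbTE nMd).
- move=> c; rewrite /L2 /L1 /K0 /A /C => Lc nLc i; rewrite d0 -val_eqE dP /= => i0.
  have nMc : ~~ misses P c by move: Lc nLc; bool_cases.
  have c1 : vtx (n.+4.+1) 1 \notin c by move: Lc nLc; bool_cases.
  have c2 : vtx (n.+4.+1) 2 \in c by move: Lc nLc; bool_cases.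
  have c3 : vtx (n.+4.+1) 3 \notin c by move: Lc nLc; bool_cases.
  have [i4|] := leqP 4 i; first by rewrite !orbT; apply: not_misses nMc _.
  case: i i0 => -[|[|[|[|//]]]] i_lt //= _ _.
  + by apply: contraNF c1; congr (_ \in c); apply: ord_inj.
  + by move: c2; congr (_ \in c); apply: ord_inj.
  + by apply: contraNF c3; congr (_ \in c); apply: ord_inj.
- by rewrite /v' -act_comp pdK act_id.
- by rewrite /L1 /K0 d_edgeC.
- rewrite Phi1C // t_e'.
  + rewrite -[RHS]act_id; congr act; apply: ordmap_eqn => i.
    by rewrite !ord_compE squashE qE dE first_edgeE ord_idE; case: i => -[|[|]].
  + by apply: notin_image => i; rewrite !ord_compE qE dE first_edgeE /=; case: i => -[|[|]].
  + by apply: notin_image => i; rewrite !ord_compE qE dE first_edgeE /=; case: i => -[|[|]].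
(* Inner at 1', between 1 and V: the facet (0, 1, V) of the result fills [H]. *)
have [||||Phi3 Phi3_lift Phi3E] := extend_inner (t := vtx (n.+4.+1) 2) (L := L3) f_inner _ _ _ _ Phi2_lift.
- by [].
- by [].
- by move=> c Kc; apply/orP; left.
- move=> c; rewrite /L3 /L2 /L1 /K0 /A /C /= !inE !misses_setU1 // !misses_setD1 // !meets_setU1 // !meets_setD1 // -!val_eqE /=.
  move=> Lc nKc; split.
  + by move: Lc nKc; bool_cases.
  + by move: Lc nKc; bool_cases.
  + by exists (vtx (n.+4.+1) 1); [move: Lc nKc; bool_cases |].
  exists (vtx (n.+4.+1) 4) => //; apply: (@not_misses _ P) => //.
  by move: Lc nKc; bool_cases.
pose b := nat_ordmap n.+2 n.+4 skip23_le.
have bE (i : 'I_n.+3) : b i = (if i <= 1 then nat_of_ord i else i + 2) :> nat.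
  by rewrite nat_ordmapE; have := ltn_ord i; case: (leqP i 1) => ?; lia.
have pbK : ord_comp p b = ord_id _.
  apply: ordmap_eqn => i; rewrite !ord_compE pE bE ord_idE.
  by case: (nat_of_ord i) => [|[|k]] //=; rewrite !addn2 /= subn2.
have b23 : (vtx (n.+4.+1) 2 \notin image b) && (vtx (n.+4.+1) 3 \notin image b).
  by apply/andP; split; apply: notin_image => i; rewrite bE;
    case: (nat_of_ord i) => [|[|[|l]]]; rewrite //= addn2.
have [b2 b3] := andP b23.
have L3b : L3 (image b) by apply/orP; right.
exists (Phi3 _ b); first by rewrite (proj2 Phi3_lift) // /v' -act_comp pbK act_id.
move=> m a /horn_facesP[k k0 ka].
have Aba : A (image (ord_comp b a)).
  have ba2 := contra (subsetP (image_compS b a) _) b2.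
  have ba3 := contra (subsetP (image_compS b a) _) b3.
  rewrite /A ba2 ba3 andbT /=.
  have kba : b k \notin image (ord_comp b a).
    apply: notin_image => i; rewrite ord_compE; apply: contra ka => /eqP eq_b.
    have -> : k = a i; last exact: mem_image.
    apply: ord_inj; have := congr1 (fun x => nat_of_ord (p x)) (ord_inj eq_b).
    by rewrite -!(ord_compE p b) pbK !ord_idE => ->.
  have [k1|k1] := eqVneq (k : nat) 1.
    have <- : b k = vtx (n.+4.+1) 1 by apply: ord_inj; rewrite bE k1.
    by rewrite kba orbT.
  apply/orP; left; apply/missesP; exists (b k) => //; move: k0 k1; rewrite bE -val_eqE /=.
  by case: (nat_of_ord k) => [|[|l]] //; rewrite addn2.
have K0ba : K0 (image (ord_comp b a)) by rewrite /K0 Aba orbT.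
have L1ba : L1 (image (ord_comp b a)) by rewrite /L1 K0ba.
have L2ba : L2 (image (ord_comp b a)) by rewrite /L2 L1ba.
rewrite -(proj1 Phi3_lift) // Phi3E // Phi2E // Phi1E // (glued_r agr) //.
by rewrite /pull ord_compA pbK ord_comp1.
Qed.

(** * Degenerate edges over a triangle with degenerate first edge *)

Lemma foldE n (i : 'I_n.+3) : fold n i = (if i <= n.+1 then (0 < i) : nat else 2) :> nat.
Proof. by rewrite nat_ordmapE; case: (leqP i n.+1) => // _; case: (nat_of_ord i). Qed.

(** Meant for the opposite of [f], whose cartesian lifts are the cocartesian lifts that [f] has. A
    cartesian edge ending at the last vertex of [H] lets that vertex be replaced by one lying over
    the vertex 1 of [s]. As the first edge of [s] is degenerate, everything then lies over a
    constant simplex. *)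
Lemma cocartesian_over_fold_degenerate (X S : sset) (f : smap X S) (s : S 2) n (x : X 0) :
  inner_fibration f ->
  (forall z : X 0, f 0 z = vertex s ord_max -> exists e : X 1,
     [/\ target e = z, f 1 e = act (last_edge 1) s &
       forall m (b : ordmap m.+2 2), ord_comp b (last_edge m.+1) = last_edge 1 ->
         cartesian_over f e (act b s)]) ->
  cocartesian_over f (act (ord_const 1 ord0) x) (act (fold n) s).
Proof.
move=> f_inner cart H H_lift He; set v := act (fold n) s in H_lift *.
have fx : act (first_edge 1) s = act (ord_const 1 ord0) (f 0 x).
  rewrite -smap_act -He (proj2 H_lift) -?act_comp.
    by congr act; apply: ordmap_eqn => i; rewrite ord_compE foldE !first_edgeE; case: i => -[|[|]].
  apply/horn_facesP; exists ord_max => //.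
  by apply: notin_image => i; rewrite first_edgeE; have := ltn_ord i; rewrite /=; lia.
have last_horn m : horn_faces ord0 (image (ord_const m (ord_max : 'I_n.+3))).
  apply/horn_facesP; exists (vtx (n.+3) 1) => //.
  by apply: notin_image => i; rewrite ord_constE.
have [e [te fe e_cart]] : exists e : X 1,
    [/\ target e = H 0 (ord_const 0 ord_max), f 1 e = act (last_edge 1) s &
       forall m (b : ordmap m.+2 2), ord_comp b (last_edge m.+1) = last_edge 1 ->
         cartesian_over f e (act b s)].
  apply: cart; rewrite (proj2 H_lift) // /v -act_comp; congr act.
  by apply: ordmap_eqn => i; rewrite ord_compE foldE !ord_constE /= ltnn.
(* A vertex w is inserted before the last one, with the lift e as last edge. *)
pose p := nat_ordmap n.+3 n.+2 (@degeneracy_le n.+2).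
pose q := nat_ordmap n.+3 1 (@indicator_le n.+2).
have pE (i : 'I_n.+4) : p i = i - (n.+2 <= i) :> nat.
  by rewrite nat_ordmapE; have := ltn_ord i; lia.
have qE (i : 'I_n.+4) : q i = (n.+2 < i) :> nat.
  by rewrite nat_ordmapE; case: (_ < _).
pose vw : 'I_n.+4 := inord n.+2.
have vwE : vw = n.+2 :> nat by rewrite inordK.
pose P i := 1 <= i <= n.+1.
pose Q i := i <= n.+1.
pose v' := act p v.
pose A (c : {set 'I_n.+4}) := (vw \notin c) && ((ord_max \notin c) || misses P c).
pose C (c : {set 'I_n.+4}) := ~~ meets Q c.
pose K0 c := C c || A c.
pose L1 c := K0 c || misses P c.
pose L2 c := L1 c || (ord_max \notin c).
have A_down : down_closed A by down_closed_tac.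
have C_down : down_closed C by down_closed_tac.
have K0_down : down_closed K0 by down_closed_tac.
have L1_down : down_closed L1 by down_closed_tac.
have L2_down : down_closed L2 by down_closed_tac.
have eqs : ((vw == ord_max) = false) * ((ord_max == vw) = false) * ((vw == ord0) = false) *
    ((ord_max == ord0 :> 'I_n.+4) = false).
  by do !split; apply/negbTE; rewrite -val_eqE /= ?vwE; lia.
have Pmax : ~~ P n.+3 by rewrite /P; lia.
have Qmax : ~~ Q n.+3 by rewrite /Q; lia.
have Pw : ~~ P vw by rewrite /P vwE; lia.
have Qw : ~~ Q vw by rewrite /Q vwE; lia.
have A_lift : partial_lift f v' A (pull p H).
  apply: pull_lift H_lift _ => c /andP[cw /orP[cm|/missesP[k /andP[k0 kn] kc]]].
    apply: (horn_faces_pull (j := ord_max)) => // l lc; rewrite pE /=.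
    by have := notin_neq lc cm; have := notin_neq lc cw; rewrite vwE /=; have := ltn_ord l; lia.
  apply: (horn_faces_pull (j := p k)) => [|l lc].
    by rewrite -val_eqE /= pE; lia.
  by have := notin_neq lc kc; have := notin_neq lc cw; rewrite vwE !pE; lia.
pose phi : simp_family X n.+3 := fun m a => act (ord_comp q a) e.
have Cge m (a : ordmap m n.+3) i : C (image a) -> (a i == n.+2 :> nat) || (a i == n.+3 :> nat).
  by move=> Ca; have := not_meets i Ca; have := ltn_ord (a i); rewrite /Q; lia.
have pqE m (a : ordmap m n.+3) : C (image a) -> 
    ord_comp (last_edge 1) (ord_comp q a) = ord_comp (fold n) (ord_comp p a).
  move=> Ca; apply: ordmap_eqn => i; rewrite !ord_compE foldE pE last_edgeE qE.
  by have /orP[/eqP->|/eqP->] := Cge _ a i Ca; rewrite ?leqnn ?ltnn ?leqnSn ?subn1 /= ?leqnn ?ltnn.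
have C_lift : partial_lift f v' C phi.
  split=> [l m a b|m a] Ca; first by rewrite /phi ord_compA act_comp.
  by rewrite /phi smap_act fe -!act_comp pqE.
have agr : agree_on (predI C A) phi (pull p H).
  move=> m a /andP[Ca /andP[aw _]].
  have a_max i : a i = ord_max.
    by apply: ord_inj; have := notin_image_neq i aw; rewrite vwE; case/orP: (Cge _ a i Ca) => /eqP->; rewrite ?eqxx.
  rewrite /phi /pull.
  have -> : ord_comp q a = ord_comp (ord_const 0 ord_max) (ord_const m ord0).
    by apply: ordmap_eqn => i; rewrite !ord_compE qE a_max ord_constE /= ltnSn.
  have -> : ord_comp p a = ord_comp (ord_const 0 ord_max) (ord_const m ord0).
    by apply: ordmap_eqn => i; rewrite !ord_compE pE a_max ord_constE /= leqnSn subn1.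
  by rewrite act_comp -/(vertex e ord_max) -/(target e) te (proj1 H_lift).
have K0_lift := glued_lift C_down A_down agr C_lift A_lift.
(* The horns filled here are outer, at the last vertex; their last edge is [e], so the cartesian
   hypothesis applies. *)
have [|||Phi1 Phi1_lift Phi1E] := extend_along_horns (t := ord_max) (L := L1) K0_down L1_down _ _ K0_lift _.
- by move=> c Kc; apply/orP; left.
- move=> c; rewrite /L1 /K0 /A /C /= !inE !misses_setU1 // !misses_setD1 // !meets_setU1 // !meets_setD1 // !eqs /=.
  by bool_cases.
- move=> psi psiE m d i d_inj di Ld nKd psi_lift.
  have dw : vw \in image d by move: nKd Ld; rewrite /L1 /K0 /A /C; bool_cases.
  have /meetsP[u + /imageP[k uk]] : meets Q (image d).
    by move: nKd Ld; rewrite /L1 /K0 /A /C; bool_cases.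
  rewrite uk /Q => k_le; have /imageP[j jw] := dw.
  have djE : d j = n.+2 :> nat by rewrite -jw vwE.
  have diE : d i = n.+3 :> nat by rewrite di.
  have lt_kj : k < j by rewrite ltnNge -(injective_leE _ _ d_inj) djE -ltnNge.
  have lt_ji : j < i by rewrite ltnNge -(injective_leE _ _ d_inj) djE diE -ltnNge.
  (* [vw] and the last vertex of the big simplex are consecutive, hence they are the last two
     vertices of the face: [i] is [m] and [j] is [m.-1]. *)
  have gap_ji := injective_gap d_inj (ltnW lt_ji).
  have gap_im : d i + (m - i) <= d ord_max by exact: (injective_gap (j := ord_max) d_inj (leq_ord i)).
  have i_lt := ltn_ord i; have d_lt := ltn_ord (d ord_max).
  have im : i = m :> nat by lia.
  have jE : j = m.-1 :> nat by lia.
  have m_gt : 1 < m by lia.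
  have i_max : i = ord_max by apply: ord_inj.
  have psi_edge (g : ordmap 1 n.+3) : g ord0 = vw -> g ord_max = ord_max -> psi 1 g = e.
    move=> g0 g1; have Cg : C (image g).
      apply/negP => /meetsP[l Ql /imageP[[[|[|//]] lt_l] lE]]; move: Ql; rewrite lE /Q.
        have -> : Ordinal lt_l = ord0 by apply: ord_inj.
        by rewrite g0 vwE ltnn.
      have -> : Ordinal lt_l = ord_max by apply: ord_inj.
      by rewrite g1 /= ltnNge leqnSn.
    have K0g : K0 (image g) by rewrite /K0 Cg.
    rewrite psiE // glued_l // /phi -[RHS]act_id; congr act; apply: ordmap_eqn.
    move=> [[|[|//]] lt_l]; rewrite ord_compE qE ord_idE /=.
      have -> : Ordinal lt_l = ord0 by apply: ord_inj.
      by rewrite g0 vwE ltnn.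
    have -> : Ordinal lt_l = ord_max by apply: ord_inj.
    by rewrite g1 /= ltnSn.
  subst i; clear uk k_le lt_kj gap_im gap_ji lt_ji im i_lt d_lt k u.
  case: m d d_inj di Ld nKd dw psi_lift j jw jE djE diE m_gt => [|[|m]] // d.
  move=> d_inj di _ _ _ psi_lift j jw jE djE diE _.
  have eq_v : act d v' = act (ord_comp (ord_comp (fold n) p) d) s by rewrite !act_comp.
  rewrite eq_v in psi_lift *.
  apply: e_cart => //.
    apply: ordmap_eqn => l; rewrite !ord_compE foldE pE !last_edgeE.
    have -> : d (last_edge m.+1 l) = (if l == ord0 then vw else ord_max).
      case: l => -[|[|//]] l_lt; rewrite ?jw -?di; congr (d _); apply: ord_inj.
        by rewrite last_edgeE jE addn0.
      by rewrite last_edgeE addn1.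
    case: l => -[|[|//]] l_lt /=.
      by rewrite vwE leqnn subn1 leqnn.
    by rewrite leqnSn subn1 ltnn.
  rewrite /pull; apply: psi_edge; rewrite ord_compE ?jw -?di; congr (d _); apply: ord_inj.
    by rewrite last_edgeE jE addn0.
  by rewrite last_edgeE addn1.
pose d := nat_ordmap n.+2 n.+3 (@bump_le n.+3).
have dE (i : 'I_n.+3) : d i = i :> nat.
  by rewrite nat_ordmapE /bump; have := ltn_ord i; lia.
have d_inj : injective d.
  by move=> i j /(congr1 (@nat_of_ord _)); rewrite !dE => /ord_inj.
have d0 : d ord0 = ord0 by apply: ord_inj; rewrite dE.
have dP (k : 'I_n.+4) : (k \in image d) = (k < n.+3).
  apply/imageP/idP => [[i ->]|k_lt]; first by rewrite dE.
  by exists (Ordinal k_lt); apply: ord_inj; rewrite dE.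
have d_edgeA : A (image (ord_comp d (first_edge n.+1))).
  by apply/andP; split; [|apply/orP; left]; apply: notin_image => i;
    rewrite ord_compE dE first_edgeE ?vwE /=; have := ltn_ord i; lia.
have [|||||||Phi2 Phi2_lift Phi2E] := extend_along_face (e := act (ord_const 1 ord0) x) (L := L2) d_inj L1_down L2_down _ _ _ _ _ _ _ Phi1_lift.
- by move=> c Lc; apply/orP; left.
- by apply/orP; right; rewrite dP /= ltnn.
- have nMd : ~~ misses P (image d :\ d ord0).
    apply/negP => /missesP[k /andP[k0 kn]]; rewrite d0 in_setD1 dP -val_eqE /=; lia.
  have Cd : meets Q (image d :\ d ord0).
    by apply/meetsP; exists (vtx (n.+4) 1); rewrite // d0 in_setD1 dP.
  have dw : vw \in image d :\ d ord0 by rewrite d0 in_setD1 dP -val_eqE /= vwE ltnSn.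
  by rewrite /L1 /K0 /A /C Cd dw (negbTE nMd).
- move=> c; rewrite /L2 /L1 /K0 /A /C => Lc nLc i; rewrite d0 -val_eqE dP /= => i0.
  have nMc : ~~ misses P c by move: Lc nLc; bool_cases.
  have cw : vw \in c by move: Lc nLc; bool_cases.
  have cm : ord_max \notin c by move: Lc nLc; bool_cases.
  have [i_lt|i_ge] := ltnP i n.+3; last first.
    apply: contraNF cm; congr (_ \in c); apply: ord_inj.
    by apply/eqP; rewrite eqn_leq i_ge andbT -ltnS ltn_ord.
  have [iw|iw] := eqVneq (i : nat) n.+2.
    by move: cw; congr (_ \in c); apply: ord_inj; rewrite vwE iw.
  have i_le : i <= n.+1 by rewrite -ltnS ltn_neqAle iw -ltnS.
  by apply: not_misses nMc _; rewrite /P lt0n i0.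
(* Without its last vertex [v'] only sees the first edge of [s], which is degenerate by [fx]. *)
- have -> : act d v' = act (ord_const n.+2 ord0) (f 0 x); last exact: cocartesian_over_degenerate.
  have -> : act d v' = act (squash n) (act (first_edge 1) s).
    rewrite /v' /v -!act_comp; congr act; apply: ordmap_eqn => i.
    rewrite !ord_compE foldE first_edgeE pE squashE dE; have := ltn_ord i.
    move=> i_lt; have -> : (i - (n.+2 <= i) <= n.+1) = true by lia.
    lia.
  by rewrite fx act_const.
- by rewrite /L1 /K0 d_edgeA !orbT.
- have d_edgeK : K0 (image (ord_comp d (first_edge n.+1))) by rewrite /K0 d_edgeA orbT.
  rewrite Phi1E // (glued_r agr) // /pull -He; congr H.
  by apply: ordmap_eqn => i; rewrite !ord_compE pE dE first_edgeE; have := ltn_ord i; lia.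
(* Inner at w: the vertex 1 comes before it and the last vertex after it. *)
have [||||Phi3 Phi3_lift Phi3E] := extend_inner (t := vw) (L := xpredT) f_inner _ _ _ _ Phi2_lift.
- by [].
- by [].
- by [].
- move=> c _; rewrite /L2 /L1 /K0 /A /C /= !inE !misses_setD1 // !meets_setD1 // !eqs eqxx /=.
  move=> nKc; split=> //.
  + move: nKc; by bool_cases.
  + exists (vtx (n.+4) 1); last by rewrite vwE.
    by apply: (@not_misses _ P) => //; move: nKc; bool_cases.
  by exists ord_max; [move: nKc; bool_cases | rewrite vwE].
pose b := nat_ordmap n.+2 n.+3 (@bump_le n.+2).
have bE (i : 'I_n.+3) : b i = bump n.+2 i :> nat.
  by rewrite nat_ordmapE /bump; have := ltn_ord i; lia.
have pbK : ord_comp p b = ord_id _.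
  by apply: ordmap_eqn => i; rewrite !ord_compE pE bE ord_idE /bump; have := ltn_ord i; lia.
exists (Phi3 _ b); first by rewrite (proj2 Phi3_lift) // /v' -act_comp pbK act_id.
move=> m a /horn_facesP[k k0 ka].
have Aba : A (image (ord_comp b a)).
  have kba : b k \notin image (ord_comp b a).
    apply: notin_image => i; rewrite ord_compE; apply: contra ka => /eqP eq_b.
    have -> : k = a i; last exact: mem_image.
    apply: ord_inj; have := congr1 (fun x => nat_of_ord (p x)) (ord_inj eq_b).
    by rewrite -!(ord_compE p b) pbK !ord_idE => ->.
  apply/andP; split.
    by apply: notin_image => i; rewrite ord_compE bE vwE /bump; lia.
  have [k2|k2] := eqVneq (k : nat) n.+2.
    have <- : b k = ord_max by apply: ord_inj; rewrite bE k2 /bump leqnn.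
    by rewrite kba.
  apply/orP; right; apply/missesP; exists (b k) => //; move: k0 k2; rewrite bE -val_eqE /= /P /bump.
  have := ltn_ord k; lia.
have K0ba : K0 (image (ord_comp b a)) by rewrite /K0 Aba orbT.
have L1ba : L1 (image (ord_comp b a)) by rewrite /L1 K0ba.
have L2ba : L2 (image (ord_comp b a)) by rewrite /L2 L1ba.
rewrite -(proj1 Phi3_lift) // Phi3E // Phi2E // Phi1E // (glued_r agr) //.
by rewrite /pull ord_compA pbK ord_comp1.
Qed.

(** * From families back to maps out of horns, and base change *)

Lemma in_hornP n (i : 'I_n.+1) m (a : simplex n m) :
  in_horn i a <-> horn_faces i (image (a : ordmap m n)).
Proof.
split=> [[j ji aj]|/horn_facesP[j ji aj]].
  apply/horn_facesP; exists j => //.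
  by apply/imageP => -[k jk]; have := aj k; rewrite jk eqxx.
by exists j => // k; apply: contra aj => /eqP<-; apply: mem_image.
Qed.

Definition horn_map (X : sset) n (i : 'I_n.+1) (phi : simp_family X n)
  (phi_nat : natural_on (horn_faces i) phi) : smap (horn i) X :=
  SMap (smap_fun := fun m (a : horn i m) => phi m (sval a))
    (fun l m b a => phi_nat _ _ _ b (iffLR (in_hornP i (sval a)) (svalP a))).

(** Outside the horn the family takes a default value, degenerate on the image of the vertex [i].
    That vertex lies in the horn only if there is another one to miss, whence [0 < n]. *)
Lemma horn_family (X : sset) n (i : 'I_n.+1) (u : smap (horn i) X) :
  0 < n -> exists2 phi : simp_family X n, natural_on (horn_faces i) phi &
    forall m (a : horn i m), phi m (sval a) = u m a.
Proof.
move=> n_gt0; have horn_i : in_horn i (ord_const 0 i : simplex n 0).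
  have [j ji] : exists j : 'I_n.+1, j != i.
    have [i0|i0] := eqVneq i ord0; last by exists ord0; rewrite eq_sym.
    by exists ord_max; rewrite i0 -val_eqE /= -lt0n.
  by exists j => // k; rewrite ord_constE eq_sym.
pose d := u 0 (exist _ _ horn_i).
pose phi : simp_family X n := fun m a =>
  match pselect (in_horn i (a : simplex n m)) with
  | left h => u m (exist _ _ h)
  | right _ => act (ord_const m ord0) d
  end.
have phiE m (a : horn i m) : phi m (sval a) = u m a.
  rewrite /phi; case: pselect => [h|[]]; last exact: svalP a.
  by case: a h => a ha h; congr (u m _); apply: eq_exist.
exists phi => // l m a b /in_hornP ha.
rewrite -[a]/(sval (exist _ _ ha : horn i m)) phiE -smap_act -phiE.
by [].
Qed.

Lemma lifts_of_fills (X S : sset) (f : smap X S) n (i : 'I_n.+1)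
  (u : smap (horn i) X) (v : smap (simplex n) S) :
  0 < n -> commutes (horn_incl i) f u v ->
  (forall phi, partial_lift f (v n (ord_id n)) (horn_faces i) phi ->
     (forall m (a : horn i m), phi m (sval a) = u m a) ->
     fills f i (v n (ord_id n)) phi) ->
  lifts (horn_incl i) f u v.
Proof.
move=> n_gt0 uv fill; have [phi phi_nat phiE] := horn_family u n_gt0.
have vE m (a : simplex n m) : v m a = act (a : ordmap m n) (v n (ord_id n)).
  by rewrite -smap_act /= ord_comp1.
have [|x fx xP] := fill phi _ phiE.
  split=> // m a /in_hornP ha.
  by rewrite -[a]/(sval (exist _ _ ha : horn i m)) phiE uv -vE.
exists (classify x); split=> m a /=; last by rewrite smap_act fx -vE.
by rewrite -phiE xP //; apply/in_hornP/svalP.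
Qed.

Lemma fills_of_lifts (X S : sset) (f : smap X S) n (i : 'I_n.+1) (v : S n)
  (phi : simp_family X n) (phi_lift : partial_lift f v (horn_faces i) phi) :
  lifts (horn_incl i) f (horn_map (proj1 phi_lift)) (classify v) -> fills f i v phi.
Proof.
case=> w [wu wv]; exists (w n (ord_id n)); first by rewrite wv /= act_id.
move=> m a /in_hornP ha; rewrite -[LHS](wu m (exist _ _ ha)) /= -smap_act /=.
by rewrite ord_comp1.
Qed.

Lemma horn_map_commutes (X S : sset) (f : smap X S) n (i : 'I_n.+1) (v : S n)
  (phi : simp_family X n) (phi_lift : partial_lift f v (horn_faces i) phi) :
  commutes (horn_incl i) f (horn_map (proj1 phi_lift)) (classify v).
Proof. by move=> m a; apply: (proj2 phi_lift); apply/in_hornP/svalP. Qed.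

Section BaseChange.
Variables (X S : sset) (f : smap X S) (k : nat) (s : S k).

Definition pullback_fst : smap (pullback f (classify s)) X.
Proof. by exists (fun n (p : pullback f (classify s) n) => (sval p).1). Defined.

Lemma base_change_lifts A B (i : smap A B)
  (u : smap A (pullback f (classify s))) (v : smap B (simplex k)) :
  commutes i (base_change f s) u v ->
  lifts i f (scomp pullback_fst u) (scomp (classify s) v) ->
  lifts i (base_change f s) u v.
Proof.
move=> uv [w [wu wv]].
pose w' n (x : B n) : pullback f (classify s) n := exist _ (w n x, v n x) (wv n x).
have w_act m n (a : ordmap m n) (x : B n) : w' m (act a x) = act a (w' n x).
  by apply: eq_exist; rewrite /= !smap_act.
exists (SMap w_act); split=> // n a; have := uv n a; have := wu n a => /=.
case: (u n a) => -[x y] /= fxy wx yv; apply: eq_exist.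
by rewrite wx -yv.
Qed.

Lemma scomp_commutes A B (i : smap A B)
  (u : smap A (pullback f (classify s))) (v : smap B (simplex k)) :
  commutes i (base_change f s) u v ->
  commutes i f (scomp pullback_fst u) (scomp (classify s) v).
Proof. by move=> uv n a /=; rewrite -uv; case: (u n a). Qed.

Lemma base_change_inner_fibration : inner_fibration f -> inner_fibration (base_change f s).
Proof.
move=> f_inner n i i_inner u v uv; apply: base_change_lifts => //.
by apply: f_inner => //; apply: scomp_commutes.
Qed.

(** A lifting problem in the base change has a fixed second component, the simplex [b] of the base;
    the first component is a lifting problem in [X] over [act b s]. *)
Lemma base_change_cocartesianP (a : simplex k 1) (e : X 1) (fe : f 1 e = act a s) :
  cocartesian_edge (base_change f s) (base_change_edge fe) <->
  forall n (b : ordmap n.+2 k), ord_comp b (first_edge n.+1) = a ->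
    cocartesian_over f e (act b s).
Proof.
split=> [e_cocart n b ba phi phi_lift phi_e | e_cocart n u v uv ue].
  apply: (fills_of_lifts (phi_lift := phi_lift)).
  pose u1 := horn_map (proj1 phi_lift).
  have u_over m (x : horn ord0 m) : f m (u1 m x) = classify s m (ord_comp b (sval x)).
    by rewrite (horn_map_commutes phi_lift) /= act_comp.
  pose u' m (x : horn ord0 m) : pullback f (classify s) m :=
    exist _ (u1 m x, ord_comp b (sval x)) (u_over m x).
  have u_act l m (c : ordmap l m) (x : horn ord0 m) : u' l (act c x) = act c (u' m x).
    by apply: eq_exist; rewrite smap_act /= ord_compA.
  have [] := e_cocart n (SMap u_act) (classify (X := simplex k) b).
  - by [].
  - by apply: eq_exist; rewrite /= phi_e ba.
  move=> w [wu wv]; exists (scomp pullback_fst w); split=> m x /=.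
    by rewrite wu.
  have := svalP (w m x); rewrite /= => ->; rewrite -act_comp.
  by have := wv m x; rewrite /= => ->.
apply: base_change_lifts => //; apply: lifts_of_fills => //.
  exact: scomp_commutes.
move=> phi phi_lift phiE; apply: (e_cocart n (v _ (ord_id _))) => //.
  have := uv 1 (horn_first_edge n); rewrite ue /= => ->.
  have := smap_act v (first_edge n.+1) (ord_id n.+2).
  by rewrite /= ord_comp1 => ->.
by rewrite -[first_edge _]/(sval (horn_first_edge n)) phiE /= ue.
Qed.

End BaseChange.

Lemma squash_unique n (b : ordmap n.+2 1) :
  ord_comp b (first_edge n.+1) = ord_id 1 -> b = squash n.
Proof.
move=> b_first; apply: ordmap_eqn => i; rewrite squashE.
have b_edge (j : 'I_2) : b (first_edge n.+1 j) = j by rewrite -ord_compE b_first ord_idE.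
have [i0|i_gt0] := posnP i.
  have -> : i = first_edge n.+1 ord0 by apply: ord_inj; rewrite first_edgeE i0.
  by rewrite b_edge.
apply/eqP; rewrite eqn_leq -ltnS ltn_ord /=.
have : b (first_edge n.+1 ord_max) <= b i by apply: ordmap_le; rewrite first_edgeE.
by rewrite b_edge.
Qed.

Lemma locally_cocartesianP (X S : sset) (f : smap X S) (e : X 1) :
  locally_cocartesian f e <-> locally_cocartesian_over f e.
Proof.
rewrite /locally_cocartesian base_change_cocartesianP; split=> e_cocart n.
  apply: e_cocart; apply: ordmap_eqn => i; rewrite ord_compE squashE first_edgeE ord_idE.
  by case: i => -[|[|]].
by move=> b /squash_unique->.
Qed.

(** * Passage to opposites *)

Lemma ord_revE m n (a : ordmap m n) i : ord_rev a i = rev_ord (a (rev_ord i)).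
Proof. by rewrite ffunE. Qed.

Lemma ord_revK m n : involutive (@ord_rev m n).
Proof. by move=> a; apply: ordmap_eq => i; rewrite !ord_revE !rev_ordK. Qed.

Lemma ord_rev_comp l m n (a : ordmap m n) (b : ordmap l m) :
  ord_rev (ord_comp a b) = ord_comp (ord_rev a) (ord_rev b).
Proof. by apply: ordmap_eq => i; rewrite !(ord_compE, ord_revE) rev_ordK. Qed.

Lemma ord_rev_last_edge n : ord_rev (last_edge n) = first_edge n.
Proof.
apply: ordmap_eqn => i; rewrite ord_revE /= last_edgeE first_edgeE /=.
by case: i => -[|[|]] //= _; lia.
Qed.

Lemma ord_rev_first_edge n : ord_rev (first_edge n) = last_edge n.
Proof. by rewrite -ord_rev_last_edge ord_revK. Qed.

Lemma ord_rev_const m n (k : 'I_n.+1) : ord_rev (ord_const m k) = ord_const m (rev_ord k).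
Proof. by apply: ordmap_eq => i; rewrite ord_revE !ord_constE. Qed.

Lemma rev_ord_max n : rev_ord (ord_max : 'I_n.+1) = ord0.
Proof. by apply: ord_inj; rewrite /= subnn. Qed.

Lemma horn_faces_rev m n (i : 'I_n.+1) (a : ordmap m n) :
  horn_faces (rev_ord i) (image (ord_rev a)) = horn_faces i (image a).
Proof.
suff half (j : 'I_n.+1) (b : ordmap m n) :
    horn_faces j (image b) -> horn_faces (rev_ord j) (image (ord_rev b)).
  by apply/idP/idP => [/half|]; rewrite ?rev_ordK ?ord_revK //; apply: half.
move=> /horn_facesP[k kj kb]; apply/horn_facesP; exists (rev_ord k).
  by rewrite (inj_eq rev_ord_inj).
apply: contra kb => /imageP[l]; rewrite ord_revE => /rev_ord_inj ->.
exact: mem_image.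
Qed.

Section Opposite.
Variables (X S : sset) (f : smap X S) (n : nat) (i : 'I_n.+1) (v : S n).

Lemma flip_lift (phi : simp_family (op_sset X) n) :
  partial_lift (op_smap f) (v : op_sset S n) (horn_faces i) phi ->
  @partial_lift X S f n v (horn_faces (rev_ord i)) (fun m a => phi m (ord_rev a)).
Proof.
move=> [phi_nat phi_v]; split=> [l m a b|m a] ha.
  have := phi_nat _ _ (ord_rev a) (ord_rev b); rewrite -ord_rev_comp => ->.
    by rewrite /= ord_revK.
  by rewrite -horn_faces_rev ord_revK.
have := phi_v _ (ord_rev a); rewrite /= ord_revK => -> //.
by rewrite -horn_faces_rev ord_revK.
Qed.

Lemma unflip_lift (phi : simp_family X n) :
  @partial_lift X S f n v (horn_faces (rev_ord i)) phi ->
  partial_lift (op_smap f) (v : op_sset S n) (horn_faces i)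
    (fun m a => phi m (ord_rev a) : op_sset X m).
Proof.
move=> [phi_nat phi_v]; split=> [l m a b|m a] ha.
  by rewrite ord_rev_comp; apply: phi_nat; rewrite horn_faces_rev.
by apply: phi_v; rewrite horn_faces_rev.
Qed.

Lemma flip_fills (phi : simp_family (op_sset X) n) :
  @fills X S f n (rev_ord i) v (fun m a => phi m (ord_rev a)) ->
  fills (op_smap f) i (v : op_sset S n) phi.
Proof.
case=> x fx xP; exists x => // m a ha.
by have := xP m (ord_rev a); rewrite horn_faces_rev ord_revK; apply.
Qed.

Lemma unflip_fills (phi : simp_family X n) :
  fills (op_smap f) i (v : op_sset S n) (fun m a => phi m (ord_rev a) : op_sset X m) ->
  @fills X S f n (rev_ord i) v phi.
Proof.
case=> x fx xP; exists x => // m a; rewrite -[a]ord_revK horn_faces_rev => ha.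
by rewrite [LHS](xP m (ord_rev a)) //= ord_revK.
Qed.

End Opposite.

Lemma op_inner_fibration (X S : sset) (f : smap X S) :
  inner_fibration f -> inner_fibration (op_smap f).
Proof.
move=> f_inner n i i_inner u v uv; apply: lifts_of_fills => // [|phi phi_lift _].
  by case/andP: i_inner => i_gt0; apply: leq_ltn_trans.
apply: flip_fills; apply: inner_horn_fills => //; last exact: flip_lift.
by rewrite /=; lia.
Qed.

Lemma op_cartesian_overP (X S : sset) (f : smap X S) (e : X 1) n (v : S n.+2) :
  @cartesian_over _ _ (op_smap f) e n v <-> cocartesian_over f e v.
Proof.
split=> e_cart phi phi_lift phi_e.
  rewrite -rev_ord_max; apply: unflip_fills; apply: e_cart.
    by apply: unflip_lift; rewrite rev_ord_max.
  by rewrite ord_rev_last_edge.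
apply: flip_fills; rewrite rev_ord_max; apply: e_cart.
  by rewrite -rev_ord_max; apply: flip_lift.
by rewrite ord_rev_first_edge.
Qed.

(** * Scaled lifting problems as plain ones *)

Definition detects_thin (X S : scaled) (p : scmap X S) :=
  forall t : X 2, thin t <-> thin (p 2 t).

Section Scaled.
Variables (X S : scaled) (p : scmap X S).
Hypothesis p_thin : detects_thin p.

Lemma sc_lifts_of_lifts (A B : scaled) (i : scmap A B) (u : scmap A X) (v : scmap B S) :
  lifts i p u v -> sc_lifts i p u v.
Proof.
case=> w [wu wv].
have w_thin (t : B 2) : thin t -> thin (w 2 t).
  by move=> /(@scmap_thin _ _ v) t_thin; apply/p_thin; rewrite wv.
by exists (ScMap w_thin).
Qed.

Lemma thin_classify n (T : simplex n 2 -> Prop) (v : S n) :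
  (forall t, T t -> thin (act (t : ordmap 2 n) v)) ->
  forall t : scale T 2, thin t -> thin (classify v 2 t).
Proof.
move=> Tv t [/Tv//|t_deg].
exact/thin_degenerate/(@smap_degenerate _ _ (classify v)).
Qed.

(** Since [p] detects thin triangles, a horn over a suitable [v] is automatically a scaled map, and
    so is any lift. Only the triangle [triangle 0 n.+1 n.+2] of [v] remains constrained. *)
Lemma sc_cartesian_edgeP (e : X 1) :
  sc_cartesian_edge p e <->
  forall n (v : S n.+2),
    (forall t : simplex n.+2 2, triangle 0 n.+1 n.+2 t -> thin (act (t : ordmap 2 n.+2) v)) ->
    cartesian_over p e v.
Proof.
split=> [e_cart n v v_thin phi phi_lift phi_e | e_cart n T u v uv ue].
  pose T : simplex n.+2 2 -> Prop := triangle 0 n.+1 n.+2.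
  pose u1 := horn_map (proj1 phi_lift).
  have u1_thin (t : sc_horn (ord_max : 'I_n.+3) T 2) : thin t -> thin (u1 2 t).
    move=> t_thin; apply/p_thin; rewrite (horn_map_commutes phi_lift).
    apply: (thin_classify v_thin).
    by case: t_thin => [Tt|t_deg]; [left | right; exact: (smap_degenerate (horn_incl _) t_deg)].
  have uv : commutes (sc_horn_incl _ T) p (ScMap u1_thin) (ScMap (thin_classify v_thin)).
    by move=> m a; apply: (horn_map_commutes phi_lift).
  have [w [wu wv]] := e_cart n _ _ uv phi_e.
  by apply: (fills_of_lifts (phi_lift := phi_lift)); exists w.
apply: sc_lifts_of_lifts; apply: lifts_of_fills => // phi phi_lift phiE.
apply: e_cart => //; last by rewrite -[last_edge _]/(sval (horn_last_edge n)) phiE.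
move=> t Tt; have -> : act (t : ordmap 2 n.+2) (v n.+2 (ord_id _)) = v 2 t.
  by have := smap_act v (t : ordmap 2 n.+2) (ord_id _); rewrite /= ord_comp1 => ->.
by apply: scmap_thin; left.
Qed.

Lemma sc_inner_horn n (i : 'I_n.+1) T :
  inner_fibration p -> 0 < i < n -> sc_rlp (sc_horn_incl i T) p.
Proof. by move=> p_inner i_inner u v uv; apply/sc_lifts_of_lifts/p_inner. Qed.

End Scaled.

Definition point_in (Z : sset) (d : Z 1) : smap (simplex 0) (collapse d) :=
  pushout_inr (classify d) (classify (X := simplex 0) (ord_const 1 ord0)).

Section Collapse.
Variables (A B X S : sset) (h : smap A B) (e : A 1) (p : smap X S).

Lemma collapse_ind (Z : sset) (d : Z 1) n (Q : collapse d n -> Prop) :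
  (forall z, Q (collapse_in d n z)) -> (forall c, Q (point_in d n c)) -> forall q, Q q.
Proof.
move=> Qz Qc q; rewrite -[q](to_pushout_repr (q : pushout_simp _ _ n)).
by case: (repr _).
Qed.

Lemma collapse_edge (Z : sset) (d : Z 1) :
  collapse_in d 1 d = act (ord_const 1 ord0) (point_in d 0 (ord_id 0)).
Proof.
have := pushout_glue (classify d) (classify (X := simplex 0) (ord_const 1 ord0)) (ord_id 1).
rewrite /= act_id /collapse_in => ->.
rewrite -[RHS](smap_act (point_in d) (ord_const 1 ord0) (ord_id 0 : simplex 0 0)).
by congr (point_in d 1 _); apply: ordmap_eq => i; rewrite !(ord_compE, ord_idE, ord_constE).
Qed.

(** The collapsed edge already lies in [A]. On it [w] agrees with [u], which factors through the
    point, so [w] descends to the pushout. *)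
Lemma collapse_lifts (u : smap (collapse e) X) (v : smap (collapse (h 1 e)) S) :
  commutes (collapse_map h e) p u v ->
  lifts h p (scomp u (collapse_in e)) (scomp v (collapse_in (h 1 e))) ->
  lifts (collapse_map h e) p u v.
Proof.
move=> uv [w [wu wv]].
have glue n (a : simplex 1 n) :
    w n (classify (h 1 e) n a) =
    scomp u (point_in e) n (classify (X := simplex 0) (ord_const 1 ord0) n a).
  transitivity (u n (collapse_in e n (classify e n a))).
    by rewrite /= -smap_act wu.
  by congr (u n _); apply: pushout_glue.
have map_in n z : collapse_map h e n (collapse_in e n z) = collapse_in (h 1 e) n (h n z).
  exact: pushout_desc_inl.
have map_pt n c : collapse_map h e n (point_in e n c) = point_in (h 1 e) n c.
  exact: pushout_desc_inr.
have desc_in n b : pushout_desc glue n (collapse_in (h 1 e) n b) = w n b.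
  exact: pushout_desc_inl.
have desc_pt n c : pushout_desc glue n (point_in (h 1 e) n c) = u n (point_in e n c).
  exact: pushout_desc_inr.
exists (pushout_desc glue); split=> n; apply: collapse_ind => [z|c].
- by rewrite map_in desc_in wu.
- by rewrite map_pt desc_pt.
- by rewrite desc_in wv.
- by rewrite desc_pt uv map_pt.
Qed.

End Collapse.

Section WeakFibration.
Variables (X S : scaled) (p : scmap X S).
Hypothesis p_thin : detects_thin p.

(** By [collapse_edge], a map out of the collapsed horn restricts to a horn whose first edge is
    degenerate. *)
Lemma sc_left_horn :
  (forall n (x : X 0) (v : S n.+2),
     (forall t : simplex n.+2 2, triangle 0 1 n.+2 t -> thin (act (t : ordmap 2 n.+2) v)) ->
     cocartesian_over p (act (ord_const 1 ord0) x) v) ->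
  forall n, sc_rlp (sc_collapse_horn_incl (horn_first_edge n) (triangle 0 1 n.+2)) p.
Proof.
move=> deg_cocart n u v uv; apply: sc_lifts_of_lifts => //; apply: collapse_lifts => //.
apply: lifts_of_fills => // [m a|phi phi_lift phiE].
  by apply: (eq_trans (uv m (collapse_in _ m a))); congr (v m _); apply: pushout_desc_inl.
apply: (deg_cocart _ (u 0 (point_in (horn_first_edge n) 0 (ord_id 0)))) => //; last first.
  apply: (eq_trans (phiE 1 (horn_first_edge n))).
  by apply: (eq_trans (congr1 (u 1) (collapse_edge _))); apply: smap_act.
move=> t Tt; have -> : act (t : ordmap 2 n.+2) (scomp v (collapse_in (horn_incl ord0 1 (horn_first_edge n))) n.+2 (ord_id _)) =
    v 2 (collapse_in (horn_incl ord0 1 (horn_first_edge n)) 2 t).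
  by rewrite -smap_act /= ord_comp1.
by apply: scmap_thin; left; exists t.
Qed.

Lemma sc_right_horn :
  (forall n (x : X 0) (v : S n.+2),
     (forall t : simplex n.+2 2, triangle 0 n.+1 n.+2 t -> thin (act (t : ordmap 2 n.+2) v)) ->
     cartesian_over p (act (ord_const 1 ord0) x) v) ->
  forall n, sc_rlp (sc_collapse_horn_incl (horn_last_edge n) (triangle 0 n.+1 n.+2)) p.
Proof.
move=> deg_cart n u v uv; apply: sc_lifts_of_lifts => //; apply: collapse_lifts => //.
apply: lifts_of_fills => // [m a|phi phi_lift phiE].
  by apply: (eq_trans (uv m (collapse_in _ m a))); congr (v m _); apply: pushout_desc_inl.
apply: (deg_cart _ (u 0 (point_in (horn_last_edge n) 0 (ord_id 0)))) => //; last first.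
  apply: (eq_trans (phiE 1 (horn_last_edge n))).
  by apply: (eq_trans (congr1 (u 1) (collapse_edge _))); apply: smap_act.
move=> t Tt; have -> : act (t : ordmap 2 n.+2) (scomp v (collapse_in (horn_incl ord_max 1 (horn_last_edge n))) n.+2 (ord_id _)) =
    v 2 (collapse_in (horn_incl ord_max 1 (horn_last_edge n)) 2 t).
  by rewrite -smap_act /= ord_comp1.
by apply: scmap_thin; left; exists t.
Qed.

End WeakFibration.

Lemma triangleP n i j k (t : simplex n 2) :
  triangle i j k t <-> forall l : 'I_3, (t : ordmap 2 n) l = nth 0 [:: i; j; k] l :> nat.
Proof.
split=> [t_eq l|t_eq].
  rewrite -t_eq (nth_map l) ?size_enum_ord // nth_ord_enum.
  by [].
apply: (@eq_from_nth _ 0); first by rewrite size_map size_enum_ord.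
move=> l; rewrite size_map size_enum_ord => l_lt.
by rewrite (nth_map ord0) ?size_enum_ord // (nth_ord_enum _ (Ordinal l_lt)) /= t_eq.
Qed.

Lemma outer_triangleE n (l : 'I_3) :
  outer_triangle n l = nth 0 [:: 0; 1; n.+2] l :> nat.
Proof. by rewrite nat_ordmapE; case: l => -[|[|[|]]] //= _; lia. Qed.

Lemma triangle_last n (t : simplex n.+2 2) :
  triangle 0 n.+1 n.+2 t <-> ord_rev t = outer_triangle n.
Proof.
split=> [/triangleP t_eq|t_eq].
  apply: ordmap_eqn => l; rewrite ord_revE outer_triangleE /= t_eq /=.
  by case: l => -[|[|[|]]] //= _; lia.
apply/triangleP => l; rewrite -[t]ord_revK t_eq ord_revE /= outer_triangleE.
by case: l => -[|[|[|]]] //= _; lia.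
Qed.

Lemma vertex_op (X : sset) n (x : X n) (i : 'I_n.+1) :
  vertex (X := op_sset X) (x : op_sset X n) i = vertex x (rev_ord i).
Proof. by rewrite /vertex /= ord_rev_const. Qed.

Lemma target_op (X : sset) (e : X 1) : target (X := op_sset X) e = source e.
Proof. by rewrite /target vertex_op rev_ord_max. Qed.

Lemma act_op_const (X : sset) m (x : X 0) :
  act (s := op_sset X) (ord_const m ord0) x = act (s := X) (ord_const m ord0) x.
Proof. by rewrite /= ord_rev_const; congr (act (ord_const m _) x); apply: ord_inj. Qed.

(** The last value of [b] is at least [b 1 = 1]. If it is 2, the outer triangle is [s] itself; if it
    is 1, the triangle is degenerate. *)
Lemma thin_corner (S : scaled) (s : S 2) n (b : ordmap n.+2 2) :
  thin s -> ord_comp b (first_edge n.+1) = first_edge 1 ->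
  thin (act (ord_comp b (outer_triangle n)) s).
Proof.
move=> s_thin b_first.
have b_edge (j : 'I_2) : b (first_edge n.+1 j) = j :> nat.
  by rewrite -ord_compE b_first first_edgeE.
have outer_edge (j : 'I_2) (l : 'I_3) : l = j :> nat -> outer_triangle n l = first_edge n.+1 j.
  by move=> lj; apply: ord_inj; rewrite outer_triangleE first_edgeE lj; case: j {lj} => -[|[|]].
have outer_max : outer_triangle n ord_max = ord_max by apply: ord_inj; rewrite outer_triangleE.
have [b2|b2] := eqVneq (b ord_max : nat) 2.
  have -> : ord_comp b (outer_triangle n) = ord_id 2; last by rewrite act_id.
  apply: ordmap_eqn => l; rewrite ord_compE ord_idE.
  have [l_lt|l_ge] := ltnP l 2; first by rewrite (outer_edge (Ordinal l_lt)) ?b_edge.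
  have -> : l = ord_max by apply: ord_inj; apply/eqP; rewrite eqn_leq l_ge -ltnS ltn_ord.
  by rewrite outer_max b2.
have -> : ord_comp b (outer_triangle n) = ord_comp (first_edge 1) (squash 0).
  apply: ordmap_eqn => l; rewrite !ord_compE first_edgeE squashE.
  have [l_lt|l_ge] := ltnP l 2.
    by rewrite (outer_edge (Ordinal l_lt)) ?b_edge //=; case: (nat_of_ord l) l_lt => [|[|]].
  have -> : l = ord_max by apply: ord_inj; apply/eqP; rewrite eqn_leq l_ge -ltnS ltn_ord.
  rewrite outer_max; apply/eqP; rewrite eqn_leq -ltnS ltn_neqAle b2 -ltnS ltn_ord /=.
  have : b (first_edge n.+1 ord_max) <= b ord_max by apply: ordmap_le; rewrite -ltnS ltn_ord.
  by rewrite b_edge.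
by rewrite act_comp; apply: thin_degenerate; do 2!eexists.
Qed.

Lemma fold_first_edge n : ord_comp (fold n) (first_edge n.+1) = first_edge 1.
Proof. by apply: ordmap_eqn => i; rewrite ord_compE foldE !first_edgeE; case: i => -[|[|]]. Qed.

Lemma outer_triangle_first_edge n :
  ord_comp (outer_triangle n) (first_edge 1) = first_edge n.+1.
Proof.
apply: ordmap_eqn => i; rewrite ord_compE outer_triangleE !first_edgeE.
by case: i => -[|[|]].
Qed.

(** * The equivalence *)

Section Proof.
Variables (S : scaled) (X : sset) (f : smap X S).
Hypothesis f_inner : inner_fibration f.

Lemma locally_cocartesian_marking : is_marking (locally_cocartesian f).
Proof.
move=> _ [a [x ->]]; apply/locally_cocartesianP => n.
have -> : a = ord_const 1 ord0 by apply: ordmap_eq => i; rewrite ord1 ord_constE.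
by rewrite smap_act act_const; apply: cocartesian_over_degenerate.
Qed.

Lemma preimage_sc_cocartesianP (e : X 1) :
  sc_cocartesian_edge (preimage_map f) e <->
  forall n (v : S n.+2), thin (act (outer_triangle n) v) -> cocartesian_over f e v.
Proof.
rewrite /sc_cocartesian_edge sc_cartesian_edgeP //; split=> e_cart n v v_thin.
  apply/op_cartesian_overP; apply: e_cart => t /triangle_last t_eq.
  by rewrite /= t_eq.
apply/op_cartesian_overP; apply: e_cart.
have := v_thin (ord_rev (outer_triangle n)); rewrite /= ord_revK; apply.
by apply/triangle_last; rewrite ord_revK.
Qed.

(** The simplices that test local cocartesianness factor through an edge, so their outer triangles
    are degenerate, hence thin. *)
Lemma sc_cocartesian_locally (e : X 1) :
  sc_cocartesian_edge (preimage_map f) e -> locally_cocartesian f e.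
Proof.
move=> /preimage_sc_cocartesianP e_cocart; apply/locally_cocartesianP => n; apply: e_cocart.
by apply: thin_degenerate; rewrite -act_comp; do 2!eexists.
Qed.

Lemma locally_sc_cocartesian (e e' : X 1) :
  source e = source e' -> f 1 e = f 1 e' -> sc_cocartesian_edge (preimage_map f) e' ->
  locally_cocartesian f e -> sc_cocartesian_edge (preimage_map f) e.
Proof.
move=> src_eq fe_eq e'_sc e_loc; apply/preimage_sc_cocartesianP => n v v_thin.
apply: (cocartesian_over_comparison (e' := e')) => //; try exact/locally_cocartesianP.
  exact/locally_cocartesianP/sc_cocartesian_locally.
by move/preimage_sc_cocartesianP: e'_sc; apply.
Qed.

Section Fibered.
Hypothesis f_fib : inner_cocartesian_fibration (preimage_map f).

Lemma sc_cocartesian_lift (x : X 0) (s : S 1) :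
  source s = f 0 x ->
  exists e, [/\ source e = x, f 1 e = s & sc_cocartesian_edge (preimage_map f) e].
Proof.
rewrite -target_op => s_x; have [e [e_x fe e_cart]] := proj2 f_fib x s s_x.
by exists e; rewrite -e_x target_op.
Qed.

(** A fibration supplies a scaled cocartesian edge with the same source and image; the comparison
    then transfers its lifting property. *)
Lemma locally_cocartesian_sc (e : X 1) :
  locally_cocartesian f e <-> sc_cocartesian_edge (preimage_map f) e.
Proof.
split=> [e_loc|]; last exact: sc_cocartesian_locally.
have [|e' [e'_src fe' e'_sc]] := sc_cocartesian_lift (x := source e) (s := f 1 e).
  by rewrite /source /vertex smap_act.
exact: (locally_sc_cocartesian (esym e'_src) (esym fe') e'_sc e_loc).
Qed.

Lemma P_fibered_of_fibration (hE : is_marking (locally_cocartesian f)) :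
  P_fibered (X := Marked hE) f.
Proof.
split=> // [s|e s e_loc s_thin fe].
  split; last by move=> e fe; case: s / fe.
  split; first exact: base_change_inner_fibration.
  move=> x a a_x; have [|e [e_src fe e_sc]] := sc_cocartesian_lift (x := (sval x).1) (s := act a s).
    have := svalP x; rewrite /= => ->; rewrite /source /vertex -act_comp; congr act.
    exact: a_x.
  exists (base_change_edge fe); split=> //.
    case: x a_x e_src => -[x y] xy /= a_x e_src; apply: eq_exist; rewrite /= -e_src.
    by congr pair; exact: a_x.
  apply/base_change_cocartesianP => n b b_first.
  move/preimage_sc_cocartesianP: e_sc; apply; apply: thin_degenerate.
  by rewrite -act_comp; do 2!eexists.
apply/base_change_cocartesianP => n b b_first.
move/locally_cocartesian_sc/preimage_sc_cocartesianP: e_loc; apply.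
rewrite -act_comp; exact: thin_corner.
Qed.

End Fibered.

Section Converse.
Hypothesis hE : is_marking (locally_cocartesian f).
Hypothesis f_P : P_fibered (X := Marked hE) f.

Lemma marked_lift (x : X 0) (s : S 1) :
  source s = f 0 x ->
  exists e, [/\ source e = x, f 1 e = s & locally_cocartesian f e].
Proof.
move=> s_x; have [[_ cocart_lift] markedP] := P_fibered_edge f_P s.
have x_over : f 0 x = classify s 0 (ord_const 0 ord0) by rewrite -s_x.
have [|[[e a] fe] [e_x /= a_id e_cocart]] :=
    cocart_lift (exist _ (x, ord_const 0 ord0) x_over) (ord_id 1).
  by rewrite /source /vertex /= ord_comp1.
subst a; have fe' : f 1 e = s by rewrite fe /= act_id.
exists e; split=> //; first by have := congr1 (fun y => (sval y).1) e_x.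
apply/(markedP _ fe'); suff -> : base_change_edge1 fe' = exist _ (e, ord_id 1) fe by [].
exact: eq_exist.
Qed.

Lemma marked_cocartesian_over (e : X 1) (s : S 2) m (b : ordmap m.+2 2) :
  locally_cocartesian f e -> thin s -> f 1 e = act (first_edge 1) s ->
  ord_comp b (first_edge m.+1) = first_edge 1 -> cocartesian_over f e (act b s).
Proof.
move=> e_loc s_thin fe; move: m b; apply/(base_change_cocartesianP fe).
exact: (P_fibered_thin f_P).
Qed.

Lemma marked_sc_cocartesian (e : X 1) :
  locally_cocartesian f e -> sc_cocartesian_edge (preimage_map f) e.
Proof.
move=> e_loc; apply/preimage_sc_cocartesianP => n v v_thin phi phi_lift phi_e.
apply: (cocartesian_over_fold f_inner) (phi_lift) (phi_e).
apply: marked_cocartesian_over (fold_first_edge n) => //.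
rewrite -act_comp outer_triangle_first_edge -phi_e (proj2 phi_lift) //.
apply/horn_facesP; exists ord_max => //; apply: notin_image => i.
by rewrite first_edgeE; have := ltn_ord i; rewrite /=; lia.
Qed.

Lemma fibration_of_P_fibered : inner_cocartesian_fibration (preimage_map f).
Proof.
have op_inner := op_inner_fibration f_inner.
have p_thin : detects_thin (op_scmap (preimage_map f)) by [].
split.
  split=> //; split.
  - by move=> n i i_inner; apply: sc_inner_horn.
  (* In terms of [f] this is the cartesian side, which the marking does not give directly. After
     folding, the last edge of the opposite triangle is the first edge of [s] in [S]; its marked
     lifts are cocartesian over the thin [s], as the preceding construction requires. *)
  - apply: sc_left_horn => // n x v v_thin.
    have {}v_thin : thin (act (s := op_sset S) (outer_triangle n) v).
      by apply: v_thin; apply/triangleP => l; apply: outer_triangleE.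
    apply: cocartesian_over_fold => //.
    apply: cocartesian_over_fold_degenerate => // z z_over.
    set s := act (outer_triangle n) v in z_over *.
    have [|e [e_z fe e_loc]] := marked_lift (x := z) (s := act (s := S) (first_edge 1) s).
      rewrite [RHS]z_over vertex_op rev_ord_max /source /vertex -act_comp.
      by congr (act _ _); apply: ordmap_eqn => i; rewrite ord_compE first_edgeE !ord_constE.
    exists e; split; first by rewrite target_op.
      by rewrite /= ord_rev_last_edge.
    move=> m b b_last; apply/op_cartesian_overP; apply: marked_cocartesian_over => //.
    by rewrite -ord_rev_last_edge -ord_rev_comp b_last ord_rev_last_edge.
  (* In terms of [f] this is the cocartesian side, settled by the marking of degenerate edges. *)
  - apply: sc_right_horn => // n x v v_thin; apply/op_cartesian_overP.
    rewrite act_op_const.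
    have /marked_sc_cocartesian/preimage_sc_cocartesianP :
        locally_cocartesian f (act (s := X) (ord_const 1 ord0) x).
      by apply: hE; exists (ord_const 1 ord0), x.
    apply; have := v_thin (ord_rev (outer_triangle n)); rewrite /= ord_revK; apply.
    by apply/triangle_last; rewrite ord_revK.
move=> x s; rewrite target_op => /marked_lift[e [e_x fe /marked_sc_cocartesian e_sc]].
by exists e; rewrite target_op.
Qed.

End Converse.
End Proof.

Theorem proposition2p4p1 (S : scaled) (X : sset) (f : smap X S) :
  inner_fibration f ->
  exists hE : is_marking (locally_cocartesian f),
    (inner_cocartesian_fibration (preimage_map f) <->
       P_fibered (X := Marked hE) f) /\
    (inner_cocartesian_fibration (preimage_map f) ->
       forall e : X 1,
         locally_cocartesian f e <-> sc_cocartesian_edge (preimage_map f) e).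
Proof.
move=> f_inner; exists (locally_cocartesian_marking f_inner); split.
  split=> [f_fib|f_P]; first exact: P_fibered_of_fibration.
  exact: fibration_of_P_fibered f_P.
by move=> f_fib e; apply: locally_cocartesian_sc.
Qed.
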